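(* Let $d\geq 2$ and let $\Delta$ be a pure connected simplicial complex (or, more generally, a pure connected simplicial poset) of dimension $d$. Assume that all faces of $\Delta$ of dimension $\leq d-2$ have connected links. Then $$h_2(\Delta)\ \geq\ \binom{d+1}{2}\, m(\Delta).$$
   Context: A simplicial poset is a finite poset $(\Delta,\preceq)$ with a unique minimal element $\emptyset$ such that for every $F\in\Delta$ the interval $[\emptyset,F]$ is a Boolean lattice. Every finite simplicial complex (ordered by inclusion) is a simplicial poset. Elements of $\Delta$ are called faces; the dimension of a face $F$ is the rank of $[\emptyset,F]$ minus $1$, and $\dim\Delta$ is the maximum dimension of a face. $\Delta$ is pure if all its maximal faces have the same dimension. A simplicial poset is the face poset of a regular CW complex $|\Delta|$ all of whose closed cells are simplices; $|\Delta|$ is homeomorphic to the barycentric subdivision $\mathrm{sd}(\Delta)$, the order complex of $\Delta\setminus\{\emptyset\}$. Topological properties of $\Delta$ (connectedness, fundamental group) refer to $|\Delta|$. The link of a face $F$ is $\mathrm{lk}(F,\Delta)=\{G\in\Delta: F\preceq G\}$, a simplicial poset with minimal element $F$ (for simplicial complexes this is isomorphic to the usual link $\{G\in\Delta: F\cup G\in\Delta, F\cap G=\emptyset\}$). For $\Delta$ of dimension $d$, $f_i(\Delta)$ is the number of $i$-dimensional faces ($f_{-1}(\Delta)=1$) and $h_i(\Delta)=\sum_{j=0}^i(-1)^{i-j}\binom{d+1-j}{i-j}f_{j-1}(\Delta)$ for $0\le i\le d+1$. For connected $\Delta$, $m(\Delta)$ denotes the minimum number of generators of the fundamental group of $|\Delta|$.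 *)

(* Defs.v *)
From HB Require Import structures.
From mathcomp Require Import all_boot all_order all_algebra.
From mathcomp Require Import all_classical all_reals all_analysis.
Import Order.TTheory GRing.Theory Num.Theory.
Import numFieldNormedType.Exports.

Set Implicit Arguments.
Unset Strict Implicit.
Unset Printing Implicit Defensive.

Local Open Scope classical_set_scope.
Local Open Scope ring_scope.

Section SimplicialPoset.
Context {disp : Order.disp_t} {P : finBPOrderType disp}.
Implicit Types (F G : P) (C A : {set P}).

Definition boolean_interval F : Prop :=
  exists (n : nat) (f : {G : P | (G <= F)%O} -> {set 'I_n}),
    bijective f /\
    forall x y, (f x \subset f y) = (sval x <= sval y)%O.

Definition chain C : bool :=
  [forall F in C, forall G in C, (F >=< G)%O].

(* The rank of the interval [\bot, F]: the length (number of elements minus   *)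
(* one) of a longest chain in it.                                             *)
Definition rank F : nat :=
  \max_(C : {set P} | chain C && [forall G in C, (G <= F)%O]) #|C|.-1.

(* Dimensions are integers because \bot, the empty face, has dimension -1.    *)
Definition face_dim F : int := (rank F)%:Z - 1.

Definition maximal_face F : Prop := forall G, (F <= G)%O -> G = F.

Definition link F : {set P} := [set G | (F <= G)%O]%SET.

(* The geometric realization of the order complex of A, in barycentric        *)
(* coordinates; as a subset of a space of functions P -> R with the topology  *)
(* of pointwise convergence, it has the Euclidean subspace topology.          *)
Definition order_complex (R : realType) A : set {ptws P -> R} :=
  [set x : P -> R | [/\ forall F, 0 <= x F,
                        \sum_F x F = 1,
                        forall F, x F != 0 -> F \in A &
                        forall F G, x F != 0 -> x G != 0 -> (F >=< G)%O]].

(* The link of F has minimal element F, which is its empty face.              *)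
Definition link_realization (R : realType) F : set {ptws P -> R} :=
  @order_complex R (link F :\ F)%SET.

End SimplicialPoset.
Arguments order_complex {disp P} R A.
Arguments link_realization {disp P} R F.

Section WholePoset.
Context {disp : Order.disp_t} (P : finBPOrderType disp).

Definition simplicial_poset : Prop := forall F : P, boolean_interval F.

Definition poset_dim : int := (\max_(F : P) rank F)%:Z - 1.

Definition pure : Prop :=
  forall F G : P, maximal_face F -> maximal_face G -> face_dim F = face_dim G.

Definition realization (R : realType) : set {ptws P -> R} :=
  order_complex R ([set: P] :\ (\bot)%O)%SET.

Definition f_number (i : int) : nat := #|[set F : P | face_dim F == i]%SET|.

(* The h-numbers of a poset of dimension d; meaningful for i <= d.+1, where   *)
(* the truncated subtractions below are exact.                                *)
Definition h_number (d i : nat) : int :=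
  \sum_(j < i.+1)
    (-1) ^+ (i - j) * 'C(d.+1 - j, i - j)%:Z * (f_number (j%:Z - 1))%:Z.

End WholePoset.
Arguments realization {disp} P R.

Section FundamentalGroup.
Context {R : realType} {T : topologicalType}.
Implicit Types (X : set T) (b : T) (g h : R -> T).

(* Loops are functions on R of which only the values on `[0, 1] matter.       *)
Definition is_loop X b g : Prop :=
  [/\ {within `[0, 1], continuous g},
      forall t, t \in `[0, 1] -> X (g t),
      g 0 = b & g 1 = b].

Definition loop_homotopic X b g h : Prop :=
  exists H : R * R -> T,
    [/\ {within `[0, 1] `*` `[0, 1], continuous H},
        forall s t, s \in `[0, 1] -> t \in `[0, 1] -> X (H (s, t)),
        forall t, t \in `[0, 1] -> H (0, t) = g t /\ H (1, t) = h t &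
        forall s, s \in `[0, 1] -> H (s, 0) = b /\ H (s, 1) = b].

Definition loop_mul g h : R -> T :=
  fun t => if t <= 2^-1 then g (2 * t) else h (2 * t - 1).

Definition loop_inv g : R -> T := fun t => g (1 - t).

(* The product of a word in the letters g_i (letter (i, false)) and g_i^-1    *)
(* (letter (i, true)).                                                        *)
Definition loop_word b n (g : 'I_n -> R -> T) (w : seq ('I_n * bool)) :
    R -> T :=
  foldr (fun a => loop_mul (if a.2 then loop_inv (g a.1) else g a.1))
        (cst b) w.

(* The fundamental group of X at b, i.e. the group of loops in X at b up to *)
(* homotopy relative to the endpoints, is generated by n elements.            *)
Definition pi1_generated X b (n : nat) : Prop :=
  exists g : 'I_n -> R -> T,
    (forall i, is_loop X b (g i)) /\
    forall h, is_loop X b h ->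
      exists w, loop_homotopic X b h (loop_word b g w).

Definition pi1_min_generators X b (m : nat) : Prop :=
  pi1_generated X b m /\ forall n, pi1_generated X b n -> (m <= n)%N.

End FundamentalGroup.

(* Main.v *)
(* Order the vertices of Delta at random and build Delta by adding them one at *)
(* a time. Adding v amounts to coning off the part of its link spanned by the  *)
(* edges towards earlier vertices, so pi_1 is generated by one edge per        *)
(* component of this part, minus a spanning tree. The link of v has a          *)
(* shelling-like order of its vertices: a first facet (d vertices), then every *)
(* further vertex is adjacent, inside a facet, to d - 1 earlier ones. Hence a  *)
(* new component can only start at the least vertex of the first facet,        *)
(* provided that it precedes v (probability d/(d+1)), or at a later vertex w   *)
(* of the order that precedes v while the d - 1 vertices next to it follow v   *)
(* (probability 1/(d(d+1))). Summing over v, the expected number of edges      *)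
(* needed is (2 f_1 + d(d-1) f_0)/(d(d+1)); subtracting the f_0 - 1 edges of a *)
(* tree gives h_2 / binom(d+1, 2).                                             *)
(* Topologically, a loop in an order complex is followed through the open      *)
(* stars of the vertices, which are star-shaped; it is thus homotopic to an    *)
(* edge path, and edges can be eliminated with the help of 2-simplices.        *)

Require Import Defs.
From mathcomp Require Import all_boot all_order all_algebra.
From mathcomp Require Import all_classical all_reals all_analysis.
From mathcomp Require Import fingroup perm ring lra zify.
Import Order.TTheory GRing.Theory Num.Theory.
Import numFieldNormedType.Exports.
Local Open Scope classical_set_scope.
Local Open Scope ring_scope.

Set Implicit Arguments.
Unset Strict Implicit.
Unset Printing Implicit Defensive.

(** * Paths and homotopies in a space of functions *)

(** A loop in an order complex is homotopic to an edge path, and an edge that closes a 2-simplex on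
    two known edges adds nothing new. So if all edges arise in this way from a set [E] of edges
    ([percolates]), the edges of [E] outside a spanning tree generate the fundamental group;
    [pi1_percolates] thus gives [#|E| - #|A| + 1] generators, where [A] is the set of nonempty
    faces.

    Given an ordering of the vertices, the set [seeds] has one vertex-face pair for each face of
    rank at least 2 and the second half of each flagged edge. By [flags_percolate], flagged edges
    yield all edges of the poset by filling in triangles, and [seeds_percolate] carries this over to
    the barycentric subdivision. The faces of rank at least 2 cancel in the count, leaving at most
    #flagged - f_0 + 1 generators.

    Connectedness of links enters through [facets_connected], from which [link_induction] orders the
    edges at each vertex [v]: first those in a facet [G0 v], then one at a time, each in a facet
    [g v e] whose other edges at [v] came earlier. Under a random ordering, [v] flags an edge in
    [G0 v] with probability at most 1/(d+1) and any other edge with probability at most 1/(d(d+1))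
    ([card_flag]). Averaging ([few_flagged]) produces an ordering with at most (2 f_1 + d(d-1)
    f_0)/(d(d+1)) flagged edges; subtracting f_0 - 1 leaves h_2 divided by the binomial
    coefficient. *)

Section Continuity.
Context {R : realType} {P : choiceType}.
Local Notation T := {ptws P -> R}.

Lemma continuous_ptwsP (U : topologicalType) (f : U -> T) :
  continuous f <-> forall F, continuous (fun t => f t F).
Proof.
split=> cf.
  move=> F t; have /cvg_sup/(_ F) cft := cf t.
  exact: (cvg_comp _ _ cft (@initial_continuous _ _ (fun g : P -> R => g F) (f t))).
move=> t; apply/cvg_sup => F.
exact: (@continuous_comp_initial _ _ _ (fun g : P -> R => g F) f (cf F) t).
Qed.

(* A constant hiding [continuous], for the tactic [cont] to match upon. *)
Definition cont (U : topologicalType) (a : U -> R) : Prop := continuous a.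

Definition clamp (t : R) : R := Num.max 0 (Num.min 1 t).

Lemma clamp_le0 t : t <= 0 -> clamp t = 0.
Proof. by rewrite /clamp /Num.min /Num.max => ?; case: (ltP 1 t) => ?; case: ltP => ? //; lra. Qed.

Lemma clamp_ge1 t : 1 <= t -> clamp t = 1.
Proof. by rewrite /clamp /Num.min /Num.max => ?; case: (ltP 1 t) => ?; case: ltP => ? //; lra. Qed.

Lemma clamp_id t : 0 <= t <= 1 -> clamp t = t.
Proof. by rewrite /clamp /Num.min /Num.max => ?; case: (ltP 1 t) => ?; case: ltP => ? //; lra. Qed.

Lemma clamp_itv t : 0 <= clamp t <= 1.
Proof. by rewrite /clamp /Num.min /Num.max; case: (ltP 1 t) => ?; case: ltP => ? //; lra. Qed.

Lemma clamp_continuous : cont clamp.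
Proof.
move=> t; apply: continuous_max; first exact: cst_continuous.
by apply: continuous_min; [exact: cst_continuous | exact: cvg_id].
Qed.

Section Combinations.
Context {U : topologicalType}.
Implicit Types a c : U -> R.

Lemma contD a c : cont a -> cont c -> cont (fun u => a u + c u).
Proof. by move=> ca cc u; apply: cvgD; [apply: ca | apply: cc]. Qed.

Lemma contN a : cont a -> cont (fun u => - a u).
Proof. by move=> ca u; apply: cvgN; apply: ca. Qed.

Lemma contM a c : cont a -> cont c -> cont (fun u => a u * c u).
Proof. by move=> ca cc u; apply: cvgM; [apply: ca | apply: cc]. Qed.

Lemma cont_min a c : cont a -> cont c ->
  cont (fun u => Num.min (a u) (c u)).
Proof. by move=> ca cc u; apply: continuous_min; [apply: ca | apply: cc]. Qed.

Lemma cont_cst (k : R) : cont (fun _ : U => k).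
Proof. by move=> u; exact: cvg_cst. Qed.

Lemma cont_comp a (f : R -> T) F : cont (fun t => f t F) -> cont a ->
  cont (fun u => f (a u) F).
Proof.
by move=> cf ca u; apply: (@continuous_comp _ _ _ a (fun t => f t F)); [apply: ca | apply: cf].
Qed.

Lemma cont_compR a (c : R -> R) : cont c -> cont a -> cont (fun u => c (a u)).
Proof. by move=> cc ca u; apply: (@continuous_comp _ _ _ a c); [apply: ca | apply: cc]. Qed.

Lemma cont_clamp a : cont a -> cont (fun u => clamp (a u)).
Proof. exact/cont_compR/clamp_continuous. Qed.

Lemma cont_comp2 a c (H : R -> R -> T) F :
  cont (fun v : R * R => H v.1 v.2 F) ->
  cont a -> cont c -> cont (fun u => H (a u) (c u) F).
Proof.
move=> cH ca cc u.
apply: (@continuous_comp _ _ _ (fun u => (a u, c u)) (fun v : R * R => H v.1 v.2 F)).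
  exact: (cvg_pair (ca u) (cc u)).
exact: cH.
Qed.

Lemma cont_sum (I : Type) (r : seq I) (B : pred I) (a : I -> U -> R) :
  (forall i, cont (a i)) -> cont (fun u => \sum_(i <- r | B i) a i u).
Proof.
move=> ca; elim: r => [|i r IH].
  have -> : (fun u => \sum_(i <- [::] | B i) a i u) = fun=> 0.
    by apply/funext => u; rewrite big_nil.
  exact: cont_cst.
have -> : (fun u => \sum_(j <- i :: r | B j) a j u) =
    if B i then (fun u => a i u + \sum_(j <- r | B j) a j u)
    else (fun u => \sum_(j <- r | B j) a j u).
  by apply/funext => u; rewrite big_cons; case: ifP.
by case: ifP => // _; exact: contD.
Qed.

End Combinations.

Lemma cont_fst : cont (fun u : R * R => u.1).
Proof. by move=> u; exact: cvg_fst. Qed.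

Lemma cont_snd : cont (fun u : R * R => u.2).
Proof. by move=> u; exact: cvg_snd. Qed.

Lemma cont_id : cont (fun u : R => u).
Proof. by move=> u; exact: cvg_id. Qed.

End Continuity.

Ltac cont := repeat lazymatch goal with
  | |- cont (fun u => u) => exact: cont_id
  | |- cont (fun u => u.1) => exact: cont_fst
  | |- cont (fun u => u.2) => exact: cont_snd
  | |- cont fst => exact: cont_fst
  | |- cont clamp => exact: clamp_continuous
  | |- cont snd => exact: cont_snd
  | |- cont (GRing.mul ?k) => exact: (contM (cont_cst (k := k)) cont_id)
  | |- cont (GRing.add ?k) => exact: (contD (cont_cst (k := k)) cont_id)
  | |- cont (@GRing.opp _) => exact: (contN cont_id)
  | |- cont (fun u => @GRing.add _ _ _) => apply: contD
  | |- cont (fun u => @GRing.mul _ _ _) => apply: contM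
  | |- cont (fun u => @GRing.opp _ _) => apply: contN
  | |- cont (fun u => clamp _) => apply: cont_clamp
  | |- cont (fun u => Num.min _ _) => apply: cont_min
  | |- cont (fun u => ?k) => exact: cont_cst
  | |- _ => assumption
  end.

Section Paths.
Context {R : realType} {P : choiceType}.
Local Notation T := {ptws P -> R}.
Implicit Types (X : set T) (x y z : T) (f g h : R -> T).

(* Paths are defined on the whole line and constant outside [0, 1], so that   *)
(* concatenation is f (2 t) + g (2 t - 1) - y and no pasting is required.     *)
Definition ppath X x y f :=
  [/\ forall F, cont (fun t => f t F), forall t, X (f t),
      forall t, t <= 0 -> f t = x & forall t, 1 <= t -> f t = y].

(** Homotopies live on the whole plane too, with boundary values prescribed on half-planes, so that
    they paste by the same addition trick. *)
Definition phom X x y f g := exists H : R -> R -> T,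
  [/\ forall F, cont (fun u : R * R => H u.1 u.2 F),
      forall s t, X (H s t),
      forall s t, t <= 0 -> H s t = x,
      forall s t, 1 <= t -> H s t = y &
      (forall s t, s <= 0 -> H s t = f t) /\ forall s t, 1 <= s -> H s t = g t].

(* Straight-line homotopy of the parameter. *)
Lemma phom_reparam X x y f (p q : R -> R) :
  (forall F, cont (fun t => f t F)) -> (forall t, X (f t)) ->
  cont p -> cont q ->
  (forall s t, 0 <= s <= 1 -> t <= 0 -> f ((1 - s) * p t + s * q t) = x) ->
  (forall s t, 0 <= s <= 1 -> 1 <= t -> f ((1 - s) * p t + s * q t) = y) ->
  phom X x y (f \o p) (f \o q).
Proof.
move=> cf Xf cp cq fx fy.
exists (fun s t => f ((1 - clamp s) * p t + clamp s * q t)); split.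
- have cp2 := cont_compR cp cont_snd; have cq2 := cont_compR cq cont_snd.
  by move=> F; apply: (cont_comp (cf F)); cont.
- by move=> s t; exact: Xf.
- by move=> s t t0; apply: fx => //; exact: clamp_itv.
- by move=> s t t0; apply: fy => //; exact: clamp_itv.
- split=> s t s01 /=.
    by rewrite clamp_le0 // subr0 mul1r mul0r addr0.
  by rewrite clamp_ge1 // subrr mul1r mul0r add0r.
Qed.

Lemma phom_refl X x y f : ppath X x y f -> phom X x y f f.
Proof.
case=> cf Xf f0 f1; exists (fun _ => f); split=> //.
by move=> F; apply: (cont_comp (cf F)); cont.
Qed.

Lemma phom_sym X x y f g : phom X x y f g -> phom X x y g f.
Proof.
case=> H [cH XH H0 H1 [Hf Hg]]; exists (fun s t => H (1 - s) t); split=> //.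
- by move=> F; apply: (cont_comp2 (cH F)); cont.
- by move=> s t; exact: H0.
- by move=> s t; exact: H1.
- by split=> s t s0; [apply: Hg | apply: Hf]; lra.
Qed.

Lemma phom_trans X x y f g h : ppath X x y g ->
  phom X x y f g -> phom X x y g h -> phom X x y f h.
Proof.
case=> cg Xg g0 g1 [H [cH XH H0 H1 [Hf Hg]]] [K [cK XK K0 K1 [Kg Kh]]].
(* For every [s] one of the two summands equals [g t], so the sum pastes the two halves and is
   continuous by construction. *)
exists (fun s t F => H (2 * s) t F + K (2 * s - 1) t F - g t F).
have E s t : (fun F => H (2 * s) t F + K (2 * s - 1) t F - g t F) =
    if s <= 2^-1 then H (2 * s) t else K (2 * s - 1) t.
  apply/funext => F; case: ifP => s2.
    rewrite (Kg (2 * s - 1)); last by lra. by rewrite addrK.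
  rewrite (Hg (2 * s)); last by lra. by rewrite [g t F + _]addrC addrK.
split.
- move=> F; apply: contD; last by apply: contN; apply: (cont_comp (cg F)); cont.
  by apply: contD; [apply: (cont_comp2 (cH F)) | apply: (cont_comp2 (cK F))]; cont.
- by move=> s t; rewrite E; case: ifP.
- by move=> s t t0; rewrite E; case: ifP => _; [exact: H0 | exact: K0].
- by move=> s t t0; rewrite E; case: ifP => _; [exact: H1 | exact: K1].
- split=> s t s0; rewrite E.
    by rewrite ifT; [apply: Hf | ]; lra.
  by rewrite ifF; [apply: Kh | ]; lra.
Qed.

Lemma loop_mulE X x y z f g : ppath X x y f -> ppath X y z g ->
  loop_mul f g = fun t F => f (2 * t) F + g (2 * t - 1) F - y F.
Proof.
move=> [_ _ _ f1] [_ _ g0 _]; apply/funext => t; rewrite /loop_mul.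
apply/funext => F; case: ifP => t2.
  rewrite (g0 (2 * t - 1)); last by lra. by rewrite addrK.
rewrite (f1 (2 * t)); last by lra. by rewrite [y F + _]addrC addrK.
Qed.

Lemma ppath_mul X x y z f g :
  ppath X x y f -> ppath X y z g -> ppath X x z (loop_mul f g).
Proof.
move=> pf pg; have E := loop_mulE pf pg.
case: pf pg => cf Xf f0 f1 [cg Xg g0 g1]; split.
- move=> F; rewrite E; apply: contD; last by cont.
  by apply: contD; [apply: (cont_comp (cf F)) | apply: (cont_comp (cg F))]; cont.
- by move=> t; rewrite /loop_mul; case: ifP.
- by move=> t t0; rewrite /loop_mul ifT; [apply: f0 | ]; lra.
- by move=> t t0; rewrite /loop_mul ifF; [apply: g1 | ]; lra.
Qed.

Lemma phom_mul X x y z f f' g g' : ppath X x y f -> ppath X y z g ->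
  ppath X x y f' -> ppath X y z g' ->
  phom X x y f f' -> phom X y z g g' ->
  phom X x z (loop_mul f g) (loop_mul f' g').
Proof.
move=> pf pg pf' pg' [H [cH XH H0 H1 [Hf Hf']]] [K [cK XK K0 K1 [Kg Kg']]].
exists (fun s => loop_mul (H s) (K s)).
have E s t F : loop_mul (H s) (K s) t F = H s (2 * t) F + K s (2 * t - 1) F - y F.
  rewrite /loop_mul; case: ifP => t2.
    rewrite (K0 s (2 * t - 1)); last by lra. by rewrite addrK.
  rewrite (H1 s (2 * t)); last by lra. by rewrite [y F + _]addrC addrK.
split.
- move=> F; under eq_fun do rewrite E.
  apply: contD; last by cont.
  by apply: contD; [apply: (cont_comp2 (cH F)) | apply: (cont_comp2 (cK F))]; cont.
- by move=> s t; rewrite /loop_mul; case: ifP.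
- by move=> s t t0; rewrite /loop_mul ifT; [apply: H0 | ]; lra.
- by move=> s t t0; rewrite /loop_mul ifF; [apply: K1 | ]; lra.
- split=> s t s0; rewrite /loop_mul; case: ifP => _.
  + exact: Hf.
  + exact: Kg.
  + exact: Hf'.
  + exact: Kg'.
Qed.

Lemma ppath_cst X x : X x -> ppath X x x (cst x).
Proof. by split=> // F; exact: cont_cst. Qed.

Lemma ppath_inv X x y f : ppath X x y f -> ppath X y x (loop_inv f).
Proof.
case=> cf Xf f0 f1; split.
- by move=> F; apply: (cont_comp (cf F)); cont.
- by move=> t; exact: Xf.
- by move=> t t0; apply: f1; lra.
- by move=> t t0; apply: f0; lra.
Qed.

Lemma phom_mulA X x y z w f g h : ppath X x y f -> ppath X y z g -> ppath X z w h ->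
  phom X x w (loop_mul (loop_mul f g) h) (loop_mul f (loop_mul g h)).
Proof.
move=> pf pg ph; have pm := ppath_mul pf (ppath_mul pg ph).
case: (pm) => cm Xm m0 m1; case: pf pg ph => _ _ f0 f1 [_ _ g0 g1] [_ _ h0 h1].
(* The reparametrization has slopes 2, 1, 1/2 with breaks at 1/4 and 1/2; being concave, it is a
   minimum of affine functions. *)
pose p (t : R) := Num.min (2 * t) (Num.min (t + 4^-1) (2^-1 * (t + 1))).
have pE t : p t = if t <= 4^-1 then 2 * t else if t <= 2^-1 then t + 4^-1 else 2^-1 * (t + 1).
  rewrite /p /Num.min; case: (ltP (2 * t)); case: (ltP (t + 4^-1)) => ??;
  by case: (leP t 4^-1) => ?; case: (leP t 2^-1) => ?; lra.
have -> : loop_mul (loop_mul f g) h = loop_mul f (loop_mul g h) \o p.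
  apply/funext => t /=; rewrite /loop_mul pE.
  case: (leP t 4^-1) => t4.
    by rewrite !ifT; [ | lra ..].
  case: (leP t 2^-1) => t2.
    case: ifP => t3; first by exfalso; lra.
    rewrite ifF; last by lra.
    by rewrite ifT; [congr g; lra | lra].
  rewrite ifF; last by lra.
  by rewrite ifF; [congr h; lra | lra].
have idE u : u = u \o (@id R) :> (R -> T) by [].
rewrite [X in phom _ _ _ _ X]idE.
apply: phom_reparam => //.
- by rewrite /p; cont.
- exact: cont_id.
- move=> s t s01 t0; apply: m0; rewrite pE /=.
  by case: (leP t 4^-1) => ?; [nra | lra].
- move=> s t s01 t0; apply: m1; rewrite pE /=.
  by case: (leP t 4^-1) => ?; case: (leP t 2^-1) => ?; nra.
Qed.

Lemma phom_mul1l X x y f : ppath X x y f -> phom X x y (loop_mul (cst x) f) f.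
Proof.
move=> pf; case: (pf) => cf Xf f0 f1.
have -> : loop_mul (cst x) f = f \o (fun t => 2 * t - 1).
  apply/funext => t; rewrite /loop_mul /=; case: ifP => t2 //.
  by rewrite f0 //; lra.
apply: (phom_reparam (f := f) (q := id)) => //.
- by cont.
- exact: cont_id.
- by move=> s t s01 t0; apply: f0 => /=; nra.
- by move=> s t s01 t0; apply: f1 => /=; nra.
Qed.

Lemma phom_mul1r X x y f : ppath X x y f -> phom X x y (loop_mul f (cst y)) f.
Proof.
move=> pf; case: (pf) => cf Xf f0 f1.
have -> : loop_mul f (cst y) = f \o (fun t => 2 * t).
  apply/funext => t; rewrite /loop_mul /=; case: ifP => t2 //.
  by rewrite f1 //; lra.
apply: (phom_reparam (f := f) (q := id)) => //.
- by cont.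
- exact: cont_id.
- by move=> s t s01 t0; apply: f0 => /=; nra.
- by move=> s t s01 t0; apply: f1 => /=; nra.
Qed.

Lemma phom_mulVr X x y f : ppath X x y f ->
  phom X x x (loop_mul f (loop_inv f)) (cst x).
Proof.
move=> pf; case: (pf) => cf Xf f0 f1.
(* A path followed by its inverse is [f] after a tent function, which the straight-line homotopy
   shrinks to 0. Outside [0, 1] the tent is negative, where [f] is constant. *)
have -> : loop_mul f (loop_inv f) = f \o (fun t => Num.min (2 * t) (2 - 2 * t)).
  apply/funext => t; rewrite /loop_mul /loop_inv /= /Num.min.
  by case: ifP => t2; case: ltP => t3; congr f; lra.
have -> : cst x = f \o (fun=> 0) :> (R -> T) by apply/funext => t /=; rewrite f0.
apply: phom_reparam => //; try by cont.
  move=> s t s01 t0; rewrite mulr0 addr0; apply: f0.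
  by rewrite mulr_ge0_le0 // /Num.min; [lra | case: ltP => ?; lra].
move=> s t s01 t0; rewrite mulr0 addr0; apply: f0.
by rewrite mulr_ge0_le0 // /Num.min; [lra | case: ltP => ?; lra].
Qed.

Definition seg x y : R -> T := fun t F => (1 - clamp t) * x F + clamp t * y F.

Lemma ppath_seg X x y :
  (forall a : R, 0 <= a <= 1 -> X (fun F => (1 - a) * x F + a * y F)) ->
  ppath X x y (seg x y).
Proof.
move=> Xxy; split.
- by move=> F; rewrite /seg; cont.
- by move=> t; apply: Xxy; exact: clamp_itv.
- by move=> t t0; apply/funext => F; rewrite /seg clamp_le0 // subr0 mul1r mul0r addr0.
- by move=> t t0; apply/funext => F; rewrite /seg clamp_ge1 // subrr mul1r mul0r add0r.
Qed.

(* The cone with apex c over f lies in X and fills the triangle. *)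
Lemma phom_star X c x y f : ppath X x y f ->
  (forall t (a : R), 0 <= a <= 1 -> X (fun F => (1 - a) * c F + a * f t F)) ->
  phom X c y (loop_mul (seg c x) f) (seg c y).
Proof.
move=> pf Xc; case: (pf) => cf Xf f0 f1.
have pcx : ppath X c x (seg c x).
  by apply: ppath_seg => a a01; rewrite -(f0 0) //; exact: Xc.
pose a (s t : R) := (1 - clamp s) * clamp (2 * t) + clamp s * clamp t.
pose p (s t : R) := (1 - clamp s) * (2 * t - 1) + clamp s * (2 + t).
have a01 s t : 0 <= a s t <= 1.
  have := clamp_itv s; have := clamp_itv (2 * t); have := clamp_itv t.
  by rewrite /a; nra.
exists (fun s t F => (1 - a s t) * c F + a s t * f (p s t) F); split.
- move=> F; apply: contD.
    by rewrite /a; cont.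
  apply: contM; first by rewrite /a; cont.
  by apply: (cont_comp (cf F)); rewrite /p; cont.
- by move=> s t; exact: Xc.
- move=> s t t0; apply/funext => F.
  by rewrite /a [clamp (2 * t)]clamp_le0 ?[clamp t]clamp_le0 //; [ring | lra ..].
- move=> s t t1; apply/funext => F.
  rewrite f1; last by rewrite /p; have := clamp_itv s; nra.
  by rewrite /a [clamp (2 * t)]clamp_ge1 ?[clamp t]clamp_ge1 //; [ring | lra ..].
- split=> s t s01; apply/funext => F.
    rewrite /a /p (clamp_le0 s01) (loop_mulE pcx pf) /seg.
    have -> : (1 - 0) * clamp (2 * t) + 0 * clamp t = clamp (2 * t) by ring.
    have -> : (1 - 0) * (2 * t - 1) + 0 * (2 + t) = 2 * t - 1 by ring.
    case: (leP t (2^-1)) => t2.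
      rewrite (f0 (2 * t - 1)); last by lra. by ring.
    by rewrite clamp_ge1; [ring | lra].
  rewrite /a /p (clamp_ge1 s01) /seg.
  have -> : (1 - 1) * clamp (2 * t) + 1 * clamp t = clamp t by ring.
  have -> : (1 - 1) * (2 * t - 1) + 1 * (2 + t) = 2 + t by ring.
  case: (leP t 0) => t0; first by rewrite clamp_le0 //; ring.
  by rewrite f1 //; lra.
Qed.
End Paths.

(** * The fundamental groupoid and words in loops *)

Section PathClasses.
Context {R : realType} {P : choiceType} (X : set {ptws P -> R}).
Local Notation T := {ptws P -> R}.
Implicit Types (x y z : T) (f g h : R -> T).

(* Homotopy classes are sets of functions, so that the groupoid laws are      *)
(* Leibniz equalities.                                                        *)
Definition pclass x y :=
  {c : set (R -> T) | exists f, ppath X x y f /\ c = phom X x y f}.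

Definition mkclass x y f (pf : ppath X x y f) : pclass x y :=
  exist _ (phom X x y f) (ex_intro _ f (conj pf erefl)).

Lemma mkclassP x y (c : pclass x y) : exists f (pf : ppath X x y f), c = mkclass pf.
Proof. by case: (svalP c) => f [pf cE]; exists f, pf; apply/eq_sig_hprop. Qed.

Lemma mkclass_eq x y f g (pf : ppath X x y f) (pg : ppath X x y g) :
  phom X x y f g -> mkclass pf = mkclass pg.
Proof.
move=> fg; apply: eq_exist; apply/funext => h; apply/propext; split.
  exact: phom_trans (phom_sym fg).
exact: phom_trans fg.
Qed.

Lemma mkclass_inj x y f g (pf : ppath X x y f) (pg : ppath X x y g) :
  mkclass pf = mkclass pg -> phom X x y f g.
Proof. by move=> [/(congr1 (fun c : set _ => c g)) ->]; exact: phom_refl. Qed.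

Definition pcomp x y z (c : pclass x y) (d : pclass y z) : pclass x z :=
  mkclass (ppath_mul (projT2 (cid (svalP c))).1 (projT2 (cid (svalP d))).1).

(** [pcomp] multiplies representatives picked by choice; compatibility of [loop_mul] with homotopy
    makes the pick immaterial. *)
Lemma pcompE x y z f g (pf : ppath X x y f) (pg : ppath X y z g) :
  pcomp (mkclass pf) (mkclass pg) = mkclass (ppath_mul pf pg).
Proof.
have rep u v h (ph : ppath X u v h) :
    let h' := projT1 (cid (svalP (mkclass ph))) in ppath X u v h' /\ phom X u v h' h.
  have [ph' E] := projT2 (cid (svalP (mkclass ph))); split=> //.
  have Eh : phom X u v h h = phom X u v _ h := congr1 (fun c : set _ => c h) E.
  by have := phom_refl ph; rewrite Eh.
have [pf' hf] := rep _ _ _ pf; have [pg' hg] := rep _ _ _ pg.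
by apply: mkclass_eq; exact: (phom_mul pf' pg' pf pg hf hg).
Qed.

Definition pone x (Xx : X x) : pclass x x := mkclass (ppath_cst Xx).

Lemma pcompA x y z w (c : pclass x y) (d : pclass y z) (e : pclass z w) :
  pcomp (pcomp c d) e = pcomp c (pcomp d e).
Proof.
case: (mkclassP c) (mkclassP d) (mkclassP e) => f [pf ->] [g [pg ->]] [h [ph ->]].
by rewrite !pcompE; apply: mkclass_eq; exact: (phom_mulA pf pg ph).
Qed.

Lemma pcomp1l x y (Xx : X x) (c : pclass x y) : pcomp (pone Xx) c = c.
Proof.
by case: (mkclassP c) => f [pf ->]; rewrite pcompE; apply: mkclass_eq; exact: (phom_mul1l pf).
Qed.

Lemma pcomp1r x y (Xy : X y) (c : pclass x y) : pcomp c (pone Xy) = c.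
Proof.
by case: (mkclassP c) => f [pf ->]; rewrite pcompE; apply: mkclass_eq; exact: (phom_mul1r pf).
Qed.

Lemma pcompVr x y (Xx : X x) f (pf : ppath X x y f) :
  pcomp (mkclass pf) (mkclass (ppath_inv pf)) = pone Xx.
Proof. by rewrite pcompE; apply: mkclass_eq; exact: (phom_mulVr pf). Qed.

Lemma pcompVl x y (Xy : X y) f (pf : ppath X x y f) :
  pcomp (mkclass (ppath_inv pf)) (mkclass pf) = pone Xy.
Proof.
rewrite pcompE; apply: mkclass_eq.
have fE : f = loop_inv (loop_inv f).
  by apply/funext => t; rewrite /loop_inv opprB addrCA subrr addr0.
by rewrite [X in loop_mul _ X]fE; exact: (phom_mulVr (ppath_inv pf)).
Qed.

Section Words.
Variables (b : T) (Xb : X b) (n : nat) (g : 'I_n -> R -> T).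
Hypothesis pg : forall i, ppath X b b (g i).

Definition letter_class (a : 'I_n * bool) : pclass b b :=
  if a.2 then mkclass (ppath_inv (pg a.1)) else mkclass (pg a.1).

Definition word_class (w : seq ('I_n * bool)) : pclass b b :=
  foldr (fun a c => pcomp (letter_class a) c) (pone Xb) w.

Lemma word_classE w :
  exists pw : ppath X b b (loop_word b g w), word_class w = mkclass pw.
Proof.
elim: w => [|[i s] w [pw IH]] /=; first by exists (ppath_cst Xb).
rewrite IH /letter_class /=; case: s => /=; rewrite pcompE.
  by exists (ppath_mul (ppath_inv (pg i)) pw).
by exists (ppath_mul (pg i) pw).
Qed.

Lemma word_class_cat v w :
  word_class (v ++ w) = pcomp (word_class v) (word_class w).
Proof.
by elim: v => [|a v IH] /=; rewrite ?pcomp1l // IH pcompA.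
Qed.

Lemma word_class_inv w : exists v, pcomp (word_class v) (word_class w) = pone Xb.
Proof.
elim: w => [|[i s] w [v IH]]; first by exists [::]; rewrite pcomp1l.
exists (v ++ [:: (i, ~~ s)]).
rewrite word_class_cat /= pcomp1r pcompA -[pcomp (letter_class (i, ~~ s)) _]pcompA.
suff -> : pcomp (letter_class (i, ~~ s)) (letter_class (i, s)) = pone Xb by rewrite pcomp1l.
by rewrite /letter_class; case: s => /=; rewrite ?pcompVr ?pcompVl.
Qed.

End Words.
End PathClasses.

(** * Order complexes *)

Section OrderComplex.
Context {R : realType} {disp : Order.disp_t} {P : finBPOrderType disp}.
Variable A : {set P}.
Local Notation T := {ptws P -> R}.
Local Notation X := (order_complex R A).
Implicit Types (F G H : P) (x y z : T) (f g h : R -> T).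

Definition delta F : T := fun G => (G == F)%:R.

(* x lies in the closed star of the vertex F. *)
Definition joinable F x := forall G, x G != 0 -> (F >=< G)%O.

Lemma delta_neq0 F G : (delta F G != 0) = (G == F).
Proof. by rewrite /delta; case: (G == F); rewrite ?oner_neq0 ?eqxx. Qed.

Lemma joinable_delta F G : (F >=< G)%O -> joinable F (delta G).
Proof. by move=> FG H; rewrite delta_neq0 => /eqP ->. Qed.

Lemma joinable_supp F x : X x -> x F != 0 -> joinable F x.
Proof. by case=> _ _ _ cx xF G; exact: cx. Qed.

Lemma delta_in F : F \in A -> X (delta F).
Proof.
move=> FA; split.
- by move=> G; rewrite ler0n.
- rewrite (bigD1 F) //= big1 ?addr0 ?/delta ?eqxx // => G /negbTE GF.
  by rewrite /delta GF.
- by move=> G; rewrite delta_neq0 => /eqP ->.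
- by move=> G H; rewrite !delta_neq0 => /eqP -> /eqP ->; exact: comparablexx.
Qed.

Lemma conv_neq0 x y (a : R) F :
  (1 - a) * x F + a * y F != 0 -> x F != 0 \/ y F != 0.
Proof.
case: (eqVneq (x F) 0) => [->|]; last by left.
case: (eqVneq (y F) 0) => [->|]; last by right.
by rewrite !mulr0 addr0 eqxx.
Qed.

Lemma joinable_conv F x y (a : R) : joinable F x -> joinable F y ->
  joinable F (fun G => (1 - a) * x G + a * y G).
Proof. by move=> Fx Fy G /conv_neq0[/Fx|/Fy]. Qed.

Lemma conv_in x y (a : R) : X x -> X y ->
  (forall F G, x F != 0 -> y G != 0 -> (F >=< G)%O) ->
  0 <= a <= 1 -> X (fun F => (1 - a) * x F + a * y F).
Proof.
case=> x0 x1 xA cx [y0 y1 yA cy] cxy /andP[a0 a1]; split.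
- by move=> F; rewrite addr_ge0 ?mulr_ge0 ?subr_ge0.
- by rewrite big_split /= -!mulr_sumr x1 y1 !mulr1 subrK.
- by move=> F /conv_neq0[/xA|/yA].
- move=> F G /conv_neq0[xF|yF] /conv_neq0[xG|yG].
  + exact: cx.
  + exact: cxy.
  + by rewrite comparable_sym; exact: cxy.
  + exact: cy.
Qed.

Lemma delta_conv_in F x (a : R) : F \in A -> X x -> joinable F x ->
  0 <= a <= 1 -> X (fun G => (1 - a) * delta F G + a * x G).
Proof.
move=> FA Xx Fx; apply: conv_in => //; first exact: delta_in.
by move=> G H; rewrite delta_neq0 => /eqP ->; exact: Fx.
Qed.

Lemma ppath_spoke F x : F \in A -> X x -> joinable F x ->
  ppath X (delta F) x (seg (delta F) x).
Proof. by move=> FA Xx Fx; apply: ppath_seg => a; exact: delta_conv_in. Qed.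

Definition spoke F x (FA : F \in A) (Xx : X x) (Fx : joinable F x) :=
  mkclass (ppath_spoke FA Xx Fx).

(** The closed star of [F] is star-shaped from [delta F], so coning off there fills the triangle
    between a path inside the star and the two spokes to its ends. *)
Lemma spoke_comp F x y FA Xx Fx Xy Fy f (pf : ppath X x y f) :
  (forall t, joinable F (f t)) ->
  pcomp (@spoke F x FA Xx Fx) (mkclass pf) = @spoke F y FA Xy Fy.
Proof.
move=> Ff; rewrite pcompE; apply: mkclass_eq; apply: phom_star => // t a a01.
by apply: delta_conv_in => //; case: pf.
Qed.

(** The segment from [delta G] to [y] stays in the closed star of [F]. When [y] is a vertex, this is
    the relation given by a 2-simplex. *)
Lemma spoke_comp_spoke F G y FA XG FG Xy Fy GA Gy :
  pcomp (@spoke F (delta G) FA XG FG) (@spoke G y GA Xy Gy) = @spoke F y FA Xy Fy.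
Proof. by apply: spoke_comp => t; apply: joinable_conv. Qed.

Lemma spoke_refl F FA XF FF : @spoke F (delta F) FA XF FF = pone XF.
Proof.
apply: mkclass_eq; have -> : seg (delta F) (delta F) = cst (delta F) :> (R -> T).
  by apply/funext => t; apply/funext => G; rewrite /seg -mulrDl subrK mul1r.
exact/phom_refl/ppath_cst.
Qed.

(* Supports are chains, so the total weight of the part of A in B only takes  *)
(* the values 0 and 1.                                                        *)
Lemma connected_order_complex (B : P -> Prop) : connected X ->
  (forall F G, F \in A -> G \in A -> (F >=< G)%O -> B F -> B G) ->
  forall F G, F \in A -> G \in A -> B F -> B G.
Proof.
move=> cX cB F G FA GA BF; apply: contrapT => nBG.
pose m (x : T) : R := \sum_(H | `[< B H >]) x H.
have cm : cont (m : T -> R).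
  apply: (@cont_sum _ T _ _ _ (fun H (x : T) => x H)) => H.
  exact: (proj1 (continuous_ptwsP (fun x : T => x)) (fun x => cvg_id)).
have cI : connected (m @` X).
  by apply: connected_continuous_connected => //; exact: continuous_subspaceT.
have mF : m (delta F) = 1.
  rewrite /m (bigD1 F) /=; last exact/asboolP.
  rewrite big1 ?addr0 ?/delta ?eqxx // => H /andP[_ /negbTE HF]; by rewrite /delta HF.
have mG : m (delta G) = 0.
  rewrite /m big1 // => H /asboolP BH; rewrite /delta; case: eqP => // HG.
  by case: nBG; rewrite -HG.
have [x Xx mx] : (m @` X) (2^-1).
  move/connected_intervalP : cI; apply.
  - by exists (delta G) => //; exact: delta_in.
  - by exists (delta F) => //; exact: delta_in.
  - by rewrite mF mG; lra.
have [x0 x1 xA cx] := Xx.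
have [[H /asboolP BH xH]|nH] := pselect (exists2 H, `[< B H >] & x H != 0).
  suff : m x = 1 by move: mx => ->; lra.
  rewrite -x1 /m big_mkcond /=; apply: eq_bigr => K _; case: asboolP => // nBK.
  apply/esym/eqP; apply: contrapT => /negP xK; apply: nBK.
  by apply: (cB H K) BH; [exact: xA | exact: xA | exact: cx].
suff : m x = 0 by move: mx => ->; lra.
rewrite /m big1 // => H BH; apply/eqP; apply: contrapT => /negP xH.
by apply: nH; exists H.
Qed.

End OrderComplex.

(** * Generators of the fundamental group from a percolating set of edges *)

Section Percolation.
Context {disp : Order.disp_t} {P : finBPOrderType disp}.

(* Comparable pairs are the edges of the order complex of A; all of them must *)
(* be obtained from E by filling in the third edge of 2-simplices.            *)
Definition percolates (A : {set P}) (E : {set P * P}) : Prop :=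
  forall K : P -> P -> Prop,
    (forall F, F \in A -> K F F) ->
    (forall F G, F \in A -> G \in A -> (F >=< G)%O -> K F G -> K G F) ->
    (forall F G H, F \in A -> G \in A -> H \in A ->
      (F >=< G)%O -> (G >=< H)%O -> (F >=< H)%O -> K F G -> K G H -> K F H) ->
    (forall F G, (F, G) \in E -> K F G) ->
    forall F G, F \in A -> G \in A -> (F >=< G)%O -> K F G.

Context {R : realType} (A : {set P}) (E : {set P * P}).
Local Notation T := {ptws P -> R}.
Local Notation X := (order_complex R A).
Hypothesis EA : forall F G, (F, G) \in E -> [/\ F \in A, G \in A & (F >=< G)%O].
Hypothesis percE : percolates A E.
Hypothesis conX : connected X.
Implicit Types (F G H : P) (x y z : T).

(** Percolation for the relation [B F <-> B G]: since the order complex is connected, so is the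
    graph on [A] with edge set [E]. *)
Lemma percolates_connected (B : P -> Prop) :
  (forall F G, (F, G) \in E -> B F <-> B G) ->
  forall F G, F \in A -> G \in A -> B F -> B G.
Proof.
move=> BE; apply: (connected_order_complex conX) => F G FA GA FG.
suff: B F <-> B G by case.
move: F G FA GA FG; apply: percE => //.
- by move=> F G _ _ _ FG; split=> /FG.
- move=> F G H _ _ _ _ _ _ FG GH; exact: (iff_trans FG GH).
Qed.

Variables (b : T) (Xb : X b) (F0 : P) (F0A : F0 \in A) (p0 : R -> T).
Hypothesis pp0 : ppath X b (delta F0) p0.

Definition ppath_edge F G (FA : F \in A) (GA : G \in A) (FG : (F >=< G)%O) :
    ppath X (delta F) (delta G) (seg (delta F) (delta G)) :=
  ppath_spoke FA (delta_in GA) (joinable_delta FG).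

Lemma edge_back F G (c : pclass X b (delta F)) FA GA FG GF :
  pcomp (pcomp c (mkclass (@ppath_edge F G FA GA FG)))
    (mkclass (@ppath_edge G F GA FA GF)) = c.
Proof.
have j := @joinable_delta R _ P F F (comparablexx F).
rewrite pcompA -[mkclass _]/(spoke FA (delta_in GA) (joinable_delta FG)).
rewrite (spoke_comp FA _ _ (delta_in FA) j).
  by rewrite spoke_refl pcomp1r.
by move=> t; apply: joinable_conv => //; exact: joinable_delta.
Qed.

(* The paths p F run through a tree S on the vertices in B, rooted at F0. *)
Definition tree_gauge k := exists (B : {set P}) (S : {set P * P}) (p : P -> R -> T),
  [/\ B \subset A, #|B| = k.+1, S \subset E, #|S| = k &
   [/\ F0 \in B, p F0 = p0, forall F, F \in B -> ppath X b (delta F) (p F),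
       forall F G, (F, G) \in S -> F \in B /\ G \in B &
       forall F G, (F, G) \in S ->
         phom X b (delta G) (loop_mul (p F) (seg (delta F) (delta G))) (p G)]].

Lemma spanning_gauge k : (k < #|A|)%N -> tree_gauge k.
Proof.
elim: k => [|k IH] kA.
  exists [set F0]%SET, finset.set0, (fun=> p0); split; rewrite ?cards1 ?cards0 //.
  - by rewrite finset.sub1set.
  - exact: finset.sub0set.
  - split=> //.
    + by rewrite set11.
    + by move=> F /set1P ->.
    + by move=> F G; rewrite inE.
    + by move=> F G; rewrite inE.
have [B [S [p [BA cB SE cS [F0B p0E pp SB Sp]]]]] := IH (ltnW kA).
(* By connectedness of the graph, some edge of [E] leaves the tree as long as its vertex set [B] is
   not all of [A]. *)
have [[F G] /= FGE FGB] : exists2 e, e \in E & (e.1 \in B) != (e.2 \in B).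
  apply: contrapT => nB.
  suff AB : A \subset B by move: (subset_leq_card AB); rewrite cB leqNgt kA.
  apply/fintype.subsetP => G GA.
  apply: (@percolates_connected (fun F => F \in B) _ F0 G) => // F H FHE.
  suff -> : (F \in B) = (H \in B) by [].
  by apply/eqP; apply: contrapT => /negP FH; apply: nB; exists (F, H).
have [FA GA FG] := EA FGE.
have GF : (G >=< F)%O by rewrite comparable_sym.
have FGS : (F, G) \notin S.
  by apply/negP => /SB[FB GB]; move: FGB; rewrite FB GB.
have step N O (NA : N \in A) (OA : O \in A) (ON : (O >=< N)%O) (OB : O \in B)
    (NB : N \notin B) :
    ((F = O /\ G = N) \/ (F = N /\ G = O)) ->
    tree_gauge k.+1.
  move=> FGNO; have NO : (N >=< O)%O by rewrite comparable_sym.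
  have BN H : H \in B -> (H == N) = false.
    by move=> HB; apply/eqP => HN; rewrite -HN HB in NB.
  have pN := ppath_mul (pp O OB) (ppath_edge OA NA ON).
  exists (N |: B)%SET, ((F, G) |: S)%SET,
    (fun H => if H == N then loop_mul (p O) (seg (delta O) (delta N)) else p H).
  split.
  - by rewrite finset.subUset finset.sub1set NA.
  - by rewrite cardsU1 NB cB.
  - by rewrite finset.subUset finset.sub1set FGE.
  - by rewrite cardsU1 FGS cS.
  - split.
    + by rewrite in_setU1 F0B orbT.
    + by rewrite BN.
    + by move=> H /setU1P[->|HB]; rewrite ?eqxx ?BN //; exact: pp.
    + move=> H K /setU1P[[-> ->]|/SB[HB KB]]; rewrite !in_setU1 ?HB ?KB ?orbT //.
      by case: FGNO => -[-> ->]; rewrite eqxx OB orbT.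
    + move=> H K /setU1P[[-> ->]|HK].
        case: FGNO => -[-> ->]; rewrite eqxx BN //; first exact: phom_refl.
        apply: (@mkclass_inj _ _ _ _ _ _ _ (ppath_mul
          (ppath_mul (pp O OB) (ppath_edge OA NA ON)) (ppath_edge NA OA NO)) (pp O OB)).
        by rewrite -!pcompE edge_back.
      by have [HB KB] := SB _ _ HK; rewrite !BN //; exact: Sp.
case: (boolP (F \in B)) FGB => FB /=; rewrite ?eqb_id ?(negbTE FB) => GB.
  by apply: (step G F) => //; left.
by apply: (step F G) => //; [case: (G \in B) GB | right].
Qed.

End Percolation.

Section Generators.
Context {disp : Order.disp_t} {P : finBPOrderType disp} {R : realType}.
Variables (A : {set P}) (E : {set P * P}).
Local Notation T := {ptws P -> R}.
Local Notation X := (order_complex R A).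
Implicit Types (F G H : P) (x y z : T) (f g h : R -> T).
Hypothesis percE : percolates A E.

Variables (b : T) (Xb : X b) (p : P -> R -> T) (n : nat) (g : 'I_n -> R -> T).
Hypothesis pp : forall F, F \in A -> ppath X b (delta F) (p F).
Hypothesis pg : forall i, ppath X b b (g i).
Hypothesis Eg : forall F G, (F, G) \in E -> forall (FA : F \in A) (GA : G \in A) (FG : (F >=< G)%O),
  exists w, pcomp (mkclass (pp FA)) (mkclass (@ppath_edge _ _ R _ F G FA GA FG)) =
            pcomp (word_class Xb pg w) (mkclass (pp GA)).

(** Being a word in the generators, once closed up by the paths [p], is a reflexive and symmetric
    property of edges that passes to the third edge of a 2-simplex. Percolation therefore extends it
    from [E] to all comparable pairs. *)
Lemma edge_word F G (FA : F \in A) (GA : G \in A) (FG : (F >=< G)%O) :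
  exists w, pcomp (mkclass (pp FA)) (mkclass (@ppath_edge _ _ R _ F G FA GA FG)) =
            pcomp (word_class Xb pg w) (mkclass (pp GA)).
Proof.
move: (FA) (GA) (FG); move: F G FA GA FG; apply: percE => //.
- move=> F _ FA FA' FF; exists [::]; rewrite (bool_irrelevance FA' FA) /= pcomp1l.
  by rewrite -[mkclass (ppath_edge _ _ _)]/(spoke FA (delta_in FA) (joinable_delta FF))
     spoke_refl pcomp1r.
- move=> F G _ _ _ FG GA FA GF.
  have FG' : (F >=< G)%O by rewrite comparable_sym.
  have [w Ew] := FG FA GA FG'; have [v Ev] := word_class_inv Xb pg w; exists v.
  rewrite -[mkclass (pp GA)](pcomp1l Xb) -Ev [pcomp (pcomp _ _) (mkclass (pp GA))]pcompA -Ew.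
  by rewrite pcompA edge_back.
- move=> F G H _ GA _ FG GH FH KFG KGH FA HA FH'.
  have [v Ev] := KFG FA GA FG; have [w Ew] := KGH GA HA GH; exists (v ++ w).
  rewrite word_class_cat pcompA -Ew -pcompA -Ev pcompA.
  congr pcomp; rewrite -[mkclass (ppath_edge FA GA FG)]/(spoke FA (delta_in GA) (joinable_delta FG)).
  by rewrite -[mkclass (ppath_edge GA HA GH)]/(spoke GA (delta_in HA) (joinable_delta GH))
     (spoke_comp_spoke _ _ _ (delta_in HA) (joinable_delta FH')).
Qed.

Section Loop.
Variables (f : R -> T) (F0 : P) (F0A : F0 \in A) (b0 : joinable F0 b).
Hypothesis pf : ppath X b b f.
Hypothesis bF0 : b F0 != 0.
Hypothesis p0 : pcomp (mkclass (pp F0A)) (spoke F0A Xb b0) = pone Xb.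

(* The part of f between times s and t, possibly run backwards. *)
Definition restr (s t : R) : R -> T := fun u => f (s + clamp u * (t - s)).

Lemma ppath_restr s t : ppath X (f s) (f t) (restr s t).
Proof.
case: pf => cf Xf f0 f1; split.
- by move=> F; apply: (cont_comp (cf F)); cont.
- by move=> u; exact: Xf.
- by move=> u u0; rewrite /restr clamp_le0 // mul0r addr0.
- by move=> u u1; rewrite /restr clamp_ge1 // mul1r addrC subrK.
Qed.

Lemma f_at0 : f 0 = b.
Proof. by case: pf => _ _ f0 _; exact: f0. Qed.

Lemma ppath_restr0 t : ppath X b (f t) (restr 0 t).
Proof. by rewrite -f_at0; exact: ppath_restr. Qed.

Lemma restr_comp s t :
  pcomp (mkclass (ppath_restr0 s)) (mkclass (ppath_restr s t)) = mkclass (ppath_restr0 t).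
Proof.
rewrite pcompE; apply: mkclass_eq; case: pf => cf Xf f0 f1.
have -> : loop_mul (restr 0 s) (restr s t) =
    f \o (fun u => clamp (2 * u) * s + clamp (2 * u - 1) * (t - s)).
  apply/funext => u; rewrite /loop_mul /restr /= add0r subr0; case: ifP => u2.
    by rewrite (@clamp_le0 _ (2 * u - 1)) ?mul0r ?addr0 //; lra.
  by rewrite (@clamp_ge1 _ (2 * u)) ?mul1r //; lra.
have -> : restr 0 t = f \o (fun u => clamp u * t).
  by apply/funext => u; rewrite /restr /= add0r subr0.
apply: phom_reparam => //; try by cont.
- move=> s' u _ u0; rewrite !clamp_le0 ?mul0r ?addr0 ?mulr0 ?addr0 ?f0 //; lra.
- move=> s' u _ u0; rewrite !clamp_ge1 ?mul1r //; last first; [lra | lra | ].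
  by congr f; ring.
Qed.

Lemma supp_nonempty x : X x -> exists2 F, F \in A & x F != 0.
Proof.
case=> _ x1 xA _; apply: contrapT => nF.
have : \sum_F x F = 0.
  apply: big1 => F _; apply/eqP; apply: contrapT => /negP xF.
  by apply: nF; exists F => //; exact: xA.
by rewrite x1 => /eqP; rewrite oner_eq0.
Qed.

Lemma f_in t : X (f t).
Proof. by case: pf. Qed.

(* Up to time t, f is a word in the generators followed by the path p F and   *)
(* the segment from F to f t, where f t is in the open star of F.             *)
Definition reached t := exists F (FA : F \in A) (tF : f t F != 0) w,
  mkclass (ppath_restr0 t) = pcomp (word_class Xb pg w)
    (pcomp (mkclass (pp FA)) (spoke FA (f_in t) (joinable_supp (f_in t) tF))).

(** Faces in the support of [f t] are comparable, so [edge_word] moves the center from [F] to [G],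
    the triangle with [f t] being filled by [spoke_comp_spoke]. *)
Lemma reached_switch t G (GA : G \in A) (tG : f t G != 0) : reached t ->
  exists w, mkclass (ppath_restr0 t) = pcomp (word_class Xb pg w)
    (pcomp (mkclass (pp GA)) (spoke GA (f_in t) (joinable_supp (f_in t) tG))).
Proof.
case=> F [FA [tF [w ->]]].
have FG : (F >=< G)%O by exact: (joinable_supp (f_in t) tF tG).
have [v Ev] := edge_word FA GA FG; exists (w ++ v).
rewrite word_class_cat pcompA -[pcomp (word_class Xb pg v) _]pcompA -Ev.
rewrite [pcomp (pcomp (mkclass (pp FA)) _) _]pcompA; congr (pcomp _ (pcomp _ _)).
rewrite -[mkclass (ppath_edge FA GA FG)]/(spoke FA (delta_in GA) (joinable_delta FG)).
by rewrite (spoke_comp_spoke _ _ _ (f_in t) (joinable_supp (f_in t) tF)).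
Qed.

Lemma reached_step s t G : G \in A ->
  (forall u, 0 <= u <= 1 -> f (s + u * (t - s)) G != 0) -> reached s -> reached t.
Proof.
move=> GA fG rs.
have sG : f s G != 0 by have := fG 0; rewrite mul0r addr0; apply; lra.
have tG : f t G != 0 by have := fG 1; rewrite mul1r [s + _]addrC subrK; apply; lra.
have [w Ew] := reached_switch GA sG rs.
exists G, GA, tG, w; rewrite -(restr_comp s t) Ew !pcompA.
congr (pcomp _ (pcomp _ _)).
apply: spoke_comp => u; apply: joinable_supp; first exact: f_in.
by apply: fG; exact: clamp_itv.
Qed.

(** Near [t], the path stays in the open star of a face in the support of [f t], where
    [reached_step] applies in both directions. *)
Lemma reached_near t : exists2 e : R, 0 < e &
  forall s, `|t - s| < e -> reached s <-> reached t.
Proof.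
have [G GA tG] := supp_nonempty (f_in t).
case: pf => cf _ _ _.
have [e /= e0 eG] : \forall u \near t, f u G != 0.
  exact: (cvgr_neq0 (f t G) (cf G t) tG).
exists e => // s ts; split; apply: (reached_step GA) => u u01; apply: eG => /=.
- have -> : t - (s + u * (t - s)) = (1 - u) * (t - s) by ring.
  rewrite normrM; apply: le_lt_trans ts.
  by rewrite ler_piMl // ger0_norm; lra.
- have -> : t - (t + u * (s - t)) = u * (t - s) by ring.
  rewrite normrM; apply: le_lt_trans ts.
  by rewrite ler_piMl // ger0_norm; lra.
Qed.

Lemma reached_all t : reached t.
Proof.
have r0 : reached 0.
  have bF : f 0 F0 != 0 by rewrite f_at0.
  exists F0, F0A, bF, [::]; rewrite pcomp1l.
  have E0 : forall y (e : y = b) (q : ppath X b y (restr 0 0)) Xy yF,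
    mkclass q = pcomp (mkclass (pp F0A)) (@spoke _ _ _ _ F0 y F0A Xy yF).
    move=> y e; rewrite e => q Xy yF.
    rewrite (Prop_irrelevance Xy Xb) (Prop_irrelevance yF b0) p0.
    apply: mkclass_eq.
    have -> : restr 0 0 = cst b :> (R -> T).
      by apply/funext => u; rewrite /restr subrr mulr0 addr0 f_at0.
    exact/phom_refl/ppath_cst.
  by apply: E0; exact: f_at0.
(* The set is nonempty, open and closed in the connected line. *)
have : [set t | reached t] = [set: R].
  have /connected_intervalP : is_interval [set: R] by [].
  apply.
  - by exists 0.
  - exists [set t | reached t]; last by rewrite setTI.
    rewrite openE => s /= rs; have [e e0 es] := reached_near s.
    by exists e => //= u /= su; apply/es.
  - exists [set t | reached t]; last by rewrite setTI.
    rewrite -[X in closed X]setCK; apply: open_closedC.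
    rewrite openE => s /= rs; have [e e0 es] := reached_near s.
    by exists e => //= u /= su ru; apply: rs; apply/(es _ su).
by move=> E1; have : [set: R] t by []; rewrite -E1.
Qed.

Lemma f_at1 : f 1 = b.
Proof. by case: pf => _ _ _ f1; exact: f1. Qed.

Lemma loop_wordP : exists w, mkclass pf = word_class Xb pg w.
Proof.
have bF : f 1 F0 != 0 by rewrite f_at1.
have [w Ew] := reached_switch F0A bF (reached_all 1); exists w.
move: (ppath_restr0 1) (f_in 1) (joinable_supp _ bF) Ew.
have -> : restr 0 1 = f.
  apply/funext => u; rewrite /restr add0r subr0 mulr1; case: pf => _ _ f0 f1.
  case: (leP u 0) => u0; first by rewrite clamp_le0 // !f0.
  case: (leP 1 u) => u1; first by rewrite clamp_ge1 // !f1.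
  by rewrite clamp_id //; lra.
rewrite f_at1 => q Xb' b0' E1.
rewrite (Prop_irrelevance pf q) E1 (Prop_irrelevance Xb' Xb) (Prop_irrelevance b0' b0) p0.
by rewrite pcomp1r.
Qed.

End Loop.
End Generators.

Section LoopsToPaths.
Context {R : realType} {P : choiceType} (X : set {ptws P -> R}).
Local Notation T := {ptws P -> R}.

(** A loop is controlled on [0, 1] only; [clamp] makes it continuous on the line and constant on
    either side. *)
Lemma ppath_loop b (h : R -> T) : is_loop X b h -> ppath X b b (h \o clamp).
Proof.
case=> ch Xh h0 h1.
have cl (t : R) : clamp t \in `[0, 1] by rewrite in_itv /=; exact: clamp_itv.
split.
- apply/continuous_ptwsP => t.
  have /subspace_continuousP/(_ (clamp t) (cl t)) cht := ch.
  apply: cvg_comp cht => U /= [e /= e0 eU].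
  have := @clamp_continuous R t (ball (clamp t) e) (nbhsx_ballx _ _ e0).
  by apply: (@filterS _ (nbhs t)) => u ue; apply: eU => /=; [exact: ue | exact: cl].
- by move=> t; exact: Xh.
- by move=> t t0; rewrite /= clamp_le0.
- by move=> t t0; rewrite /= clamp_ge1.
Qed.

Lemma phom_loop_homotopic b (h g : R -> T) :
  phom X b b (h \o clamp) g -> loop_homotopic X b h g.
Proof.
case=> H [cH XH H0 H1 [Hh Hg]]; exists (fun u => H u.1 u.2); split.
- exact/continuous_subspaceT/continuous_ptwsP.
- by move=> s t _ _; exact: XH.
- move=> t; rewrite in_itv /= => t01.
  by rewrite Hh // Hg //= clamp_id.
- by move=> s _ /=; rewrite H0 // H1.
Qed.

End LoopsToPaths.

Section PercolationTheorem.
Context {disp : Order.disp_t} {P : finBPOrderType disp} {R : realType}.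
Local Notation T := {ptws P -> R}.

(** Tree edges give the empty word with respect to the tree paths, so the other edges of [E], closed
    up to loops by these paths, generate; the tree has [#|A|.-1] edges. *)
Lemma pi1_percolates (A : {set P}) (E : {set P * P}) (b : T) :
  (forall F G, (F, G) \in E -> [/\ F \in A, G \in A & (F >=< G)%O]) ->
  percolates A E -> connected (order_complex R A) -> order_complex R A b ->
  exists2 n, pi1_generated (R := R) (order_complex R A) b n &
    (n + #|A| = #|E|.+1)%N.
Proof.
move=> EA percE conX Xb; set X := order_complex R A.
have [F0 F0A bF0] := supp_nonempty Xb.
have b0 := joinable_supp Xb bF0.
pose q0 := ppath_spoke F0A Xb b0.
have A0 : (0 < #|A|)%N by apply/card_gt0P; exists F0.
have [|B [S [p [BA cB SE cS [_ p0E pp SB Sp]]]]] :=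
  @spanning_gauge _ _ R A E EA percE conX b F0 F0A _ (ppath_inv q0) #|A|.-1.
  by rewrite prednK.
have {}BA : B = A by apply/eqP; rewrite eqEcard BA cB prednK // leqnn.
rewrite {B}BA in cB pp SB.
exists #|E :\: S|%SET; last first.
  rewrite cardsD (finset.setIidPr SE) cS -(prednK A0) addnS /= subnK //.
  by rewrite -cS; exact: subset_leq_card.
pose e (i : 'I_#|(E :\: S)%SET|) := enum_val i.
have eE i : [/\ (e i).1 \in A, (e i).2 \in A & ((e i).1 >=< (e i).2)%O].
  apply: EA; rewrite -surjective_pairing; have := enum_valP i.
  by rewrite finset.in_setD => /andP[].
pose pe i := let: And3 FA GA FG := eE i in
  ppath_mul (ppath_mul (pp _ FA) (@ppath_edge _ _ R _ _ _ FA GA FG)) (ppath_inv (pp _ GA)).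
pose g i := loop_mul (loop_mul (p (e i).1) (seg (delta (e i).1) (delta (e i).2)))
  (loop_inv (p (e i).2)).
have pg i : ppath X b b (g i) by exact: pe.
exists g; split=> [i|h hl].
  have [cf Xf f0 f1] := pg i; split.
  - exact/continuous_subspaceT/continuous_ptwsP.
  - by move=> t _; exact: Xf.
  - exact: f0.
  - exact: f1.
have pf := ppath_loop hl.
have Eg F G : (F, G) \in E -> forall FA GA FG,
    exists w, pcomp (mkclass (pp F FA)) (mkclass (@ppath_edge _ _ R _ F G FA GA FG)) =
              pcomp (word_class Xb pg w) (mkclass (pp G GA)).
  move=> FGE FA GA FG; have [FGS|FGS] := boolP ((F, G) \in S).
    exists [::]; rewrite pcomp1l pcompE; apply: mkclass_eq; exact: Sp.
  have FGD : (F, G) \in (E :\: S)%SET by rewrite finset.in_setD FGS.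
  have ei : e (enum_rank_in FGD (F, G)) = (F, G) by rewrite /e enum_rankK_in.
  exists [:: (enum_rank_in FGD (F, G), false)].
  rewrite /= pcomp1r /letter_class /=.
  move: (pg (enum_rank_in FGD (F, G))); rewrite /g ei /= => pg'.
  have -> : mkclass pg' = mkclass (ppath_mul (ppath_mul (pp F FA) (ppath_edge FA GA FG))
                                     (ppath_inv (pp G GA))).
    by apply: mkclass_eq; exact: phom_refl.
  by rewrite -!pcompE pcompA (pcompVl (delta_in GA)) pcomp1r.
have [|w Ew] := @loop_wordP _ _ R A E percE b Xb p _ g pp pg Eg _ F0 F0A b0 pf bF0.
  rewrite pcompE; apply: mkclass_eq; rewrite p0E.
  apply: (@mkclass_inj _ _ _ _ _ _ _ (ppath_mul (ppath_inv q0) q0) (ppath_cst Xb)).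
  by rewrite -pcompE; exact: pcompVl.
have [pw Ew'] := word_classE Xb pg w.
exists w; apply: phom_loop_homotopic.
by apply: (@mkclass_inj _ _ _ _ _ _ _ pf pw); rewrite Ew.
Qed.

End PercolationTheorem.

(** * Vertices and edges of simplicial posets *)

Section BooleanIntervals.
Local Open Scope nat_scope.
Context {disp : Order.disp_t} {P : finBPOrderType disp}.
Implicit Types (F G H v w x y : P).

Definition vert F : {set P} := [set v | (rank v == 1%N) && (v <= F)%O]%SET.

Section Labels.
Variables (F : P) (n : nat) (phi : P -> {set 'I_n}).
Hypothesis phi_le : forall G H, (G <= F)%O -> (H <= F)%O -> (phi G \subset phi H) = (G <= H)%O.
Hypothesis phi_sur : forall S, exists2 G, (G <= F)%O & phi G = S.

(** Along a chain below [G] the label sets have distinct sizes, at most [#|phi G|]; conversely the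
    initial segments of an enumeration of [phi G] label a chain of full length. *)
Lemma rank_labels G : (G <= F)%O -> rank G = #|phi G|.
Proof.
move=> GF; apply/eqP; rewrite eqn_leq; apply/andP; split.
  apply/bigmax_leqP => C /andP[chC /forall_inP CG].
  suff: (#|C| <= #|phi G|.+1)%N by case: #|C|.
  pose c H : 'I_#|phi G|.+1 := inord #|phi H|.
  have cE H : H \in C -> c H = #|phi H| :> nat.
    move=> HC; rewrite inordK // ltnS subset_leq_card // phi_le ?CG //.
    exact: le_trans (CG _ HC) GF.
  rewrite -[X in (_ <= X)%N]card_ord -(@card_in_imset _ _ c C).
    exact: max_card.
  move=> H K HC KC /(congr1 val) /=; rewrite !cE // => eHK.
  have HF := le_trans (CG _ HC) GF; have KF := le_trans (CG _ KC) GF.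
  have /forall_inP/(_ _ HC)/forall_inP/(_ _ KC) := chC.
  have key H' K' : (H' <= F)%O -> (K' <= F)%O -> (H' <= K')%O -> #|phi H'| = #|phi K'| -> H' = K'.
    move=> HF' KF' le e; apply/eqP; rewrite eq_le le -phi_le //=.
    have := le; rewrite -phi_le // => s.
    by have /eqP -> : phi H' == phi K' by rewrite eqEcard s e leqnn.
  by case/orP => le; [exact: key | apply/esym/key].
pose m := #|phi G|.
pose s (k : 'I_m.+1) := [set i in take k (enum (phi G))]%SET.
pose c (k : 'I_m.+1) := xget \bot%O [set H | (H <= F)%O /\ phi H = s k].
have cP k : (c k <= F)%O /\ phi (c k) = s k.
  by rewrite /c; case: xgetP => [H -> []//|/(_ _)]; have [H HF HS] := phi_sur (s k); case/(_ H).
have cards k : #|phi (c k)| = k.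
  rewrite (cP k).2 cardsE (card_uniqP _) ?take_uniq ?enum_uniq // size_takel //.
  by rewrite -cardE -ltnS.
have cI : injective c.
  by move=> k l ckl; apply: val_inj; rewrite /= -cards ckl cards.
have -> : #|phi G| = #|(c @: [set: 'I_m.+1])%SET|.-1 by rewrite card_imset // cardsT card_ord.
apply: (@leq_bigmax_cond _ (fun C : {set P} => chain C && [forall H in C, (H <= G)%O])
  (fun C : {set P} => #|C|.-1)).
apply/andP; split.
  apply/forall_inP => _ /imsetP[k _ ->]; apply/forall_inP => _ /imsetP[l _ ->].
  wlog kl : k l / (k <= l)%N => [wl|].
    by case: (leqP k l) => [/wl//|/ltnW/wl]; rewrite comparable_sym.
  apply/orP; left; rewrite -phi_le ?(cP _).1 // !(cP _).2.
  apply/fintype.subsetP => i; rewrite !inE => ik.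
  by rewrite -(subnKC kl) takeD mem_cat ik.
apply/forall_inP => _ /imsetP[k _ ->]; rewrite -phi_le ?(cP _).1 // (cP _).2.
by apply/fintype.subsetP => i; rewrite inE => /mem_take; rewrite mem_enum.
Qed.

Lemma vert_labels : exists psi : 'I_n -> P, injective psi /\
  forall G, (G <= F)%O -> vert G = (psi @: phi G)%SET.
Proof.
have /choice[psi psiP] : forall i, exists G, (G <= F)%O /\ phi G = [set i]%SET.
  by move=> i; have [G GF GE] := phi_sur [set i]%SET; exists G.
exists psi; split=> [i j eij|G GF].
  by have := (psiP i).2; rewrite eij (psiP j).2 => /finset.set1_inj.
apply/setP => v; rewrite inE; apply/andP/imsetP => [[/eqP v1 vG]|[i iG ->]].
  have vF := le_trans vG GF.
  move: v1; rewrite (rank_labels vF) => /eqP/cards1P[i vi]; exists i.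
    by rewrite -finset.sub1set -vi phi_le.
  have [iF iE] := psiP i.
  by apply/eqP; rewrite eq_le -(phi_le vF iF) -(phi_le iF vF) iE vi subxx.
split; first by rewrite (rank_labels (psiP i).1) (psiP i).2 cards1.
by rewrite -phi_le ?(psiP _).1 // (psiP i).2 finset.sub1set.
Qed.

End Labels.

Hypothesis sP : simplicial_poset P.

Lemma labelsP F : exists n (phi : P -> {set 'I_n}),
  (forall G H, (G <= F)%O -> (H <= F)%O -> (phi G \subset phi H) = (G <= H)%O) /\
  (forall S, exists2 G, (G <= F)%O & phi G = S).
Proof.
have [n [f [[g fK gK] fle]]] := sP F.
exists n, (fun G => if insub G is Some x then f x else finset.set0); split=> [G H GF HF|S].
  by rewrite !insubT fle.
by exists (val (g S)); [exact: (valP (g S)) | rewrite valK gK].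
Qed.

Lemma card_vert F : #|vert F| = rank F.
Proof.
have [n [phi [phi_le phi_sur]]] := labelsP F.
have [psi [psiI vE]] := vert_labels phi_le phi_sur.
by rewrite vE // card_imset // (rank_labels phi_le).
Qed.

Lemma vert_sub F G H : (G <= F)%O -> (H <= F)%O ->
  (vert G \subset vert H) = (G <= H)%O.
Proof.
have [n [phi [phi_le phi_sur]]] := labelsP F.
have [psi [psiI vE]] := vert_labels phi_le phi_sur.
move=> GF HF; rewrite !vE // -phi_le //; apply/idP/idP; last exact: imsetS.
move=> /fintype.subsetP s; apply/fintype.subsetP => i iG.
by have := s (psi i) (imset_f _ iG); rewrite mem_imset.
Qed.

(** The common upper bound [F] matters: in a simplicial poset distinct faces may have the same
    vertices. For this reason edges at [v], not their other endpoints, serve as the vertices of the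
    link of [v]. *)
Lemma vert_inj F G H : (G <= F)%O -> (H <= F)%O -> vert G = vert H -> G = H.
Proof.
by move=> GF HF GH; apply/eqP; rewrite eq_le -(vert_sub GF HF) -(vert_sub HF GF) GH subxx.
Qed.

Lemma vert_ex F (S : {set P}) : S \subset vert F ->
  exists2 G, (G <= F)%O & vert G = S.
Proof.
have [n [phi [phi_le phi_sur]]] := labelsP F.
have [psi [psiI vE]] := vert_labels phi_le phi_sur.
rewrite vE // => /fintype.subsetP SF.
have [G GF GE] := phi_sur (psi @^-1: S)%SET; exists G => //.
rewrite vE // GE; apply/setP => v; apply/imsetP/idP => [[i + ->]|vS].
  by rewrite inE.
have /imsetP[i _ vi] := SF _ vS; exists i => //; by rewrite inE -vi.
Qed.

Lemma vert_mono F G : (F <= G)%O -> vert F \subset vert G.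
Proof. by move=> FG; rewrite (@vert_sub G). Qed.

Lemma mem_vert F v : v \in vert F -> (v <= F)%O.
Proof. by rewrite inE => /andP[]. Qed.

Lemma rank_vert F v : v \in vert F -> rank v = 1%N.
Proof. by rewrite inE => /andP[/eqP]. Qed.

Lemma vertI F v : rank v = 1%N -> (v <= F)%O -> v \in vert F.
Proof. by rewrite inE => -> ->. Qed.

Lemma rank_bot : rank (\bot%O : P) = 0%N.
Proof.
have [n [phi [phi_le phi_sur]]] := labelsP (\bot%O : P).
rewrite (rank_labels phi_le) //; have [G G0 GE] := phi_sur finset.set0.
apply/eqP; rewrite cards_eq0; apply/eqP.
by have -> : \bot%O = G by apply/eqP; rewrite eq_le le0x G0.
Qed.

Lemma rank_eq0 F : (rank F == 0%N) = (F == \bot%O).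
Proof.
apply/eqP/eqP => [|->]; last exact: rank_bot.
rewrite -card_vert => /eqP; rewrite cards_eq0 => /eqP F0.
apply: (@vert_inj F) => //.
by apply/esym/eqP; rewrite F0 -cards_eq0 card_vert rank_bot.
Qed.

Lemma rank_mono F G : (F <= G)%O -> (rank F <= rank G)%N.
Proof. by move=> FG; rewrite -!card_vert subset_leq_card // vert_mono. Qed.

Lemma rank_inj F G : (F <= G)%O -> (rank G <= rank F)%N -> F = G.
Proof.
move=> FG GF; apply: (@vert_inj G) => //; apply/eqP.
by rewrite eqEcard vert_mono // !card_vert.
Qed.

Lemma rank_lt F G : (F < G)%O -> (rank F < rank G)%N.
Proof.
move=> FG; rewrite ltnNge; apply/negP => GF.
by have := FG; rewrite (rank_inj (ltW FG) GF) ltxx.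
Qed.

Lemma edge_ex F v w : v \in vert F -> w \in vert F -> v != w ->
  exists e, [/\ (e <= F)%O, rank e = 2 & vert e = [set v; w]%SET].
Proof.
move=> vF wF vw; have [|e eF ve] := @vert_ex F [set v; w]%SET.
  by rewrite finset.subUset !finset.sub1set vF wF.
by exists e; split=> //; rewrite -card_vert ve cards2 vw.
Qed.

Definition opp v e : P := odflt v [pick w in (vert e :\ v)%SET].

Lemma oppP v e : rank e = 2 -> v \in vert e ->
  opp v e != v /\ vert e = [set v; opp v e]%SET.
Proof.
rewrite -card_vert => e2 ve.
have /cards1P[w ew] : #|(vert e :\ v)%SET| == 1%N.
  by move: e2; rewrite (cardsD1 v) ve add1n => -[->].
have wv : w != v by have : w \in (vert e :\ v)%SET by [rewrite ew set11]; rewrite !inE; case/andP.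
rewrite /opp; case: pickP => [w'|/(_ w)]; rewrite ew ?set11 // => /set1P ->.
by split=> //=; rewrite -ew finset.setD1K.
Qed.

Lemma opp_vert v e : rank e = 2 -> v \in vert e -> opp v e \in vert e.
Proof. by move=> e2 ve; rewrite (oppP e2 ve).2 !inE eqxx orbT. Qed.

Lemma opp_unique v w e : rank e = 2 -> v != w -> vert e = [set v; w]%SET -> opp v e = w.
Proof.
move=> e2 vw ve; have vE : v \in vert e by rewrite ve !inE eqxx.
have [ov _] := oppP e2 vE; have := opp_vert e2 vE.
by rewrite ve !inE (negbTE ov) => /eqP.
Qed.

End BooleanIntervals.

(** * Strong connectivity and an ordering of the edges at a vertex *)

Section VertexLinks.
Local Open Scope nat_scope.
Context {disp : Order.disp_t} {P : finBPOrderType disp}.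
Implicit Types (F G H e t v w x y : P).
Hypothesis sP : simplicial_poset P.
Variable d : nat.
Hypothesis facet_above : forall F, exists2 G, (F <= G)%O & rank G = d.+1.
Hypothesis linkC : forall F, (rank F < d)%N -> forall B : P -> Prop,
  (forall G H, (F < G)%O -> (F < H)%O -> (G >=< H)%O -> B G -> B H) ->
  forall G H, (F < G)%O -> (F < H)%O -> B G -> B H.

Lemma rank_le_dim F : (rank F <= d.+1)%N.
Proof. by have [G FG <-] := facet_above F; exact: rank_mono. Qed.

Lemma facet_max F G : rank F = d.+1 -> (F <= G)%O -> G = F.
Proof. by move=> Fd FG; apply/esym/(rank_inj sP) => //; rewrite Fd rank_le_dim. Qed.

(** Facets above [F] are linked by steps through common ridges above [F], phrased as transport of
    [Q]. By induction on the corank: having [Q] on all facets above [K] passes to larger faces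
    trivially, and to a smaller [L] because the induction hypothesis at [L] spreads [Q] from a facet
    above [K]. Connectedness of the link of [F] does the rest. *)
Lemma facets_connected F (Q : P -> Prop) :
  (forall S G H, rank S = d -> (F <= S)%O -> (S <= G)%O -> (S <= H)%O ->
     rank G = d.+1 -> rank H = d.+1 -> Q G -> Q H) ->
  forall G H, (F <= G)%O -> (F <= H)%O -> rank G = d.+1 -> rank H = d.+1 -> Q G -> Q H.
Proof.
have [n] := ubnP (d.+1 - rank F)%N; elim: n => // n IH in F *.
rewrite ltnS => Fn Qadj G H FG FH Gd Hd QG.
have [Fd|dF|Fd] := ltngtP (rank F) d; last exact: (Qadj F G H).
  have FK K : (F <= K)%O -> rank K = d.+1 -> (F < K)%O.
    move=> FK Kd; rewrite lt_neqAle FK andbT; apply/eqP => FE.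
    by move: Fd; rewrite FE Kd ltnNge leqnSn.
  pose B K := forall K', (K <= K')%O -> rank K' = d.+1 -> Q K'.
  suff : B H by apply.
  apply: (@linkC F Fd B _ G H) => //; [|exact: FK|exact: FK|]; last first.
    by move=> K GK Kd; rewrite (facet_max Gd GK).
  move=> K L FltK FltL /orP[KL|LK] BK M LM Md; first by apply: BK => //; exact: le_trans LM.
  have [N KN Nd] := facet_above K.
  apply: (IH L _ _ N M) => //; [|  |exact: le_trans KN|exact: BK].
    by have := rank_lt sP FltL; have := rank_le_dim L; lia.
  by move=> S G' H' Sd LS; apply: Qadj => //; exact: le_trans (ltW FltL) LS.
have Fd : rank F = d.+1 by apply/eqP; rewrite eqn_leq rank_le_dim dF.
by rewrite (facet_max Fd FH) -(facet_max Fd FG).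
Qed.

Definition edges_at v : {set P} := [set e | (rank e == 2) && (v <= e)%O]%SET.

Lemma edges_atP v e : rank v = 1%N -> e \in edges_at v -> rank e = 2 /\ v \in vert e.
Proof. by move=> v1; rewrite inE => /andP[/eqP-> ve]; split=> //; exact: vertI. Qed.

Lemma edges_at_opp v F e e' : rank v = 1%N -> e \in edges_at v -> e' \in edges_at v ->
  (e <= F)%O -> (e' <= F)%O -> opp v e = opp v e' -> e = e'.
Proof.
move=> v1 /(edges_atP v1)[e2 ve] /(edges_atP v1)[e2' ve'] eF eF' oe.
by apply: (vert_inj sP eF eF'); rewrite (oppP sP e2 ve).2 (oppP sP e2' ve').2 oe.
Qed.

Lemma card_edges_at v F : rank v = 1%N -> (v <= F)%O ->
  #|[set e in edges_at v | (e <= F)%O]%SET| = (rank F).-1.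
Proof.
move=> v1 vF.
have vvF : v \in vert F by exact: vertI.
rewrite -(card_vert sP) [in RHS](cardsD1 v) vvF add1n /=.
rewrite -(@card_in_imset _ _ (opp v) [set e in edges_at v | (e <= F)%O]%SET).
  apply: eq_card => w; apply/imsetP/idP => [[e]|].
    rewrite inE => /andP[ev eF] ->; have [e2 ve] := edges_atP v1 ev.
    rewrite !inE; have [-> _] := oppP sP e2 ve.
    by have := opp_vert sP e2 ve; rewrite inE => /andP[-> oe] /=; exact: le_trans eF.
  rewrite in_setD1 => /andP[wv wF].
  have [|e [eF e2 ee]] := edge_ex sP vvF wF; first by rewrite eq_sym.
  exists e; last by rewrite (opp_unique sP e2 _ ee) // eq_sym.
  by rewrite !inE e2 eqxx eF andbT /= mem_vert // ee !inE eqxx.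
move=> e e'; rewrite !inE => /andP[ev eF] /andP[ev' eF'].
by apply: (edges_at_opp v1 _ _ eF eF'); rewrite inE.
Qed.

(* The order on the vertices of the link of v (that is, on the edges at v) in *)
(* which every vertex e outside of the facet G0 is adjacent, within the facet *)
(* g e, to d - 1 earlier ones is encoded by its induction principle.          *)
Lemma link_induction v : rank v = 1%N -> (1 < d)%N -> exists G0 (g : P -> P),
  [/\ rank G0 = d.+1, (v <= G0)%O,
      forall e, e \in edges_at v -> rank (g e) = d.+1 /\ (e <= g e)%O &
      forall Z : P -> Prop,
        (forall e, e \in edges_at v -> (e <= G0)%O -> Z e) ->
        (forall e, e \in edges_at v -> ~~ (e <= G0)%O ->
           (forall e', e' \in edges_at v -> (e' <= g e)%O -> e' != e -> Z e') -> Z e) ->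
        forall e, e \in edges_at v -> Z e].
Proof.
move=> v1 d1; have [G0 vG0 G0d] := facet_above v; exists G0.
(* A good set is an initial part of the wanted order; one of maximal size turns out to contain every
   edge at [v]. *)
pose good (B : {set P}) := B \subset edges_at v /\
  (forall e, e \in edges_at v -> (e <= G0)%O -> e \in B) /\ exists g : P -> P,
  (forall e, e \in B -> rank (g e) = d.+1 /\ (e <= g e)%O) /\
  forall Z : P -> Prop,
        (forall e, e \in edges_at v -> (e <= G0)%O -> Z e) ->
        (forall e, e \in B -> ~~ (e <= G0)%O ->
           (forall e', e' \in edges_at v -> (e' <= g e)%O -> e' != e -> Z e') -> Z e) ->
        forall e, e \in B -> Z e.
suff : good (edges_at v) by case=> _ [_ [g [gP gZ]]]; exists g.
pose B0 := [set e in edges_at v | (e <= G0)%O]%SET.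
have B0P : `[< good B0 >].
  apply/asboolP; split; first by apply/fintype.subsetP => e; rewrite inE => /andP[].
  split; first by move=> e ev eG; rewrite inE ev.
  exists (fun=> G0); split; first by move=> e; rewrite inE => /andP[].
  by move=> Z Z0 _ e; rewrite inE => /andP[]; exact: Z0.
case: (@arg_maxnP _ B0 (fun B => `[< good B >]) (fun B : {set P} => #|B|) B0P).
move=> B /asboolP goodB maxB.
suff <- : B = edges_at v by [].
have [Bv [BG0 [g [gP gZ]]]] := goodB.
apply/eqP; rewrite finset.eqEsubset Bv /=; apply: contrapT => /negP vB.
have [e0 e0v e0B] : exists2 e, e \in edges_at v & e \notin B by exact/subsetPn.
have [e02 ve0] := edges_atP v1 e0v.
have [G1 eG1 G1d] := facet_above e0.
pose Q G := forall e, e \in edges_at v -> (e <= G)%O -> e \in B.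
(* Strong connectivity gives a covered facet [G] and an uncovered [H] sharing a ridge [S] through
   [v]. Edges at [v] inside [S] are covered, so [H] has exactly one new edge, which can be appended
   with [H] as its facet. *)
have [S [G [H [[Sd vS SG SH] [Gd Hd QG nQH]]]]] : exists S G H,
    [/\ rank S = d, (v <= S)%O, (S <= G)%O & (S <= H)%O] /\
    [/\ rank G = d.+1, rank H = d.+1, Q G & ~ Q H].
  apply: contrapT => nE.
  suff Q1 : Q G1 by move: (Q1 e0 e0v eG1); rewrite (negbTE e0B).
  apply: (@facets_connected v Q _ G0 G1) => //; last first.
    by apply: le_trans eG1; exact: mem_vert ve0.
  move=> S G H Sd vS SG SH Gd Hd QG; apply: contrapT => nQH.
  by apply: nE; exists S, G, H.
have [e [ev eH eB]] : exists e, [/\ e \in edges_at v, (e <= H)%O & e \notin B].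
  apply: contrapT => nE; apply: nQH => e ev eH; apply: contrapT => /negP eB.
  by apply: nE; exists e.
have [e2 ve] := edges_atP v1 ev.
have vSS : v \in vert S by exact: vertI.
have inS w x : w \in vert H -> w \notin vert S -> x \in vert H -> x != w -> x \in vert S.
  move=> wH wS xH xw; apply: contrapT => /negP xS.
  have : (#|x |: (w |: vert S)| <= #|vert H|)%N.
    apply: subset_leq_card; rewrite !finset.subUset !finset.sub1set wH xH /=.
    exact: vert_mono.
  by rewrite !cardsU1 in_setU1 negb_or xw xS wS (card_vert sP S) (card_vert sP H) Sd Hd !add1n ltnn.
have oneS e' : e' \in edges_at v -> (e' <= H)%O -> opp v e' \in vert S -> (e' <= S)%O.
  move=> ev' eH' oS; have [e2' ve'] := edges_atP v1 ev'.
  rewrite -(vert_sub sP eH' SH) (oppP sP e2' ve').2.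
  by rewrite finset.subUset !finset.sub1set vSS.
have oe : opp v e \notin vert S.
  apply/negP => oS; have eS := oneS e ev eH oS.
  by move: eB; rewrite (QG e ev (le_trans eS SG)).
have eG0 : ~~ (e <= G0)%O by apply/negP => eG0; move: eB; rewrite BG0.
have oH f : f \in edges_at v -> (f <= H)%O -> opp v f \in vert H.
  move=> fv fH; have [f2 vf] := edges_atP v1 fv.
  by have /fintype.subsetP := vert_mono sP fH; apply; exact: opp_vert.
suff : good (e |: B)%SET.
  by move=> /asboolP /maxB; rewrite /geq /= cardsU1 eB add1n ltnn.
split; first by rewrite finset.subUset finset.sub1set ev.
split; first by move=> f fv fG0; rewrite in_setU1 BG0 ?orbT.
have neB f : f \in B -> (f == e) = false.
  by move=> fB; apply/eqP => fe; move: eB; rewrite -fe fB.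
exists (fun f => if f == e then H else g f); split.
  by move=> f /setU1P[->|fB]; rewrite ?eqxx // neB //; exact: gP.
move=> Z Z0 Z1.
have ZB f : f \in B -> Z f.
  apply: gZ => // h hB hG0 hZ; apply: Z1 => //; first by rewrite in_setU1 hB orbT.
  by move=> e' ev'; rewrite neB //; exact: hZ.
move=> f /setU1P[->|]; last exact: ZB.
apply: Z1 => //; first by rewrite setU11.
rewrite eqxx => e' ev' eH' ee'; apply: ZB.
apply: QG => //; apply: le_trans SG; apply: oneS => //.
apply: (inS (opp v e)) => //; [exact: oH | exact: oH |].
apply/eqP => oe'; move/eqP: ee'; apply; exact: (edges_at_opp v1 ev' ev eH' eH).
Qed.
End VertexLinks.

(** * Percolation from an ordering of the vertices *)

Section Flags.
Local Open Scope nat_scope.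
Context {disp : Order.disp_t} {P : finBPOrderType disp}.
Implicit Types (F G H e t u v w x y : P) (D : {set P}).
Hypothesis sP : simplicial_poset P.

Definition first (k : P -> nat) D w : bool :=
  (w \in D) && [forall u in D, (u != w) ==> (k w < k u)%N].

Lemma first_ex (k : P -> nat) D x : injective k -> x \in D -> exists w, first k D w.
Proof.
move=> kI xD; case: (@arg_minnP _ x (mem D) k xD) => w wD wmin; exists w.
apply/andP; split=> //; apply/forall_inP => u uD; apply/implyP => uw.
rewrite ltn_neqAle wmin // andbT; apply: contra uw => /eqP/kI ->.
exact: eqxx.
Qed.

Lemma first_lt (k : P -> nat) D w u : first k D w -> u \in D -> u != w -> (k w < k u)%N.
Proof. by case/andP=> _ /forall_inP h uD uw; exact: (implyP (h u uD)). Qed.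

(* For an edge e at v, coning off the earlier part of the link of v may       *)
(* require e as a new generator.                                              *)
Definition flag (k : P -> nat) (G0 : P -> P) (g : P -> P -> P) v e : bool :=
  [&& rank v == 1%N, e \in edges_at v &
      if (e <= G0 v)%O then first k (vert (G0 v)) (opp v e)
      else first k (vert (g v e)) (opp v e) &&
           first k (vert (g v e) :\ opp v e)%SET v].

Lemma triangle_ex F u v w : u \in vert F -> v \in vert F -> w \in vert F ->
  u != v -> u != w -> v != w ->
  exists t, [/\ (t <= F)%O, rank t = 3 & vert t = (u |: (v |: [set w]))%SET].
Proof.
move=> uF vF wF uv uw vw; have [|t tF ve] := @vert_ex _ _ sP F (u |: (v |: [set w]))%SET.
  by rewrite !finset.subUset !finset.sub1set uF vF wF.
exists t; split=> //; rewrite -(card_vert sP) ve !cardsU1 cards1 !inE negb_or.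
by rewrite uv uw vw.
Qed.

Lemma edge_triangle F u v w e : u \in vert F -> v \in vert F -> w \in vert F ->
  u != v -> u != w -> v != w -> (e <= F)%O -> vert e = [set v; w]%SET ->
  exists t e1 e2, [/\ rank t = 3, [/\ rank e1 = 2, rank e2 = 2 & e1 != e2],
    [/\ (e1 <= t)%O, (e2 <= t)%O, (e <= t)%O, (e1 <= F)%O & (e2 <= F)%O],
    vert e1 = [set v; u]%SET & vert e2 = [set w; u]%SET].
Proof.
move=> uF vF wF uv uw vw eF ve.
have [t [tF t3 vt]] := triangle_ex uF vF wF uv uw vw.
have [|e1 [e1F e12 ve1]] := edge_ex sP vF uF; first by rewrite eq_sym.
have [|e2 [e2F e22 ve2]] := edge_ex sP wF uF; first by rewrite eq_sym.
exists t, e1, e2; split=> //; split=> //.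
- apply/eqP => e12E; have : v \in vert e2 by rewrite -e12E ve1 !inE eqxx.
  by rewrite ve2 !inE (negbTE vw) eq_sym (negbTE uv).
- by rewrite -(vert_sub sP e1F tF) ve1 vt finset.subUset !finset.sub1set !inE !eqxx ?orbT.
- by rewrite -(vert_sub sP e2F tF) ve2 vt finset.subUset !finset.sub1set !inE !eqxx ?orbT.
- by rewrite -(vert_sub sP eF tF) ve vt finset.subUset !finset.sub1set !inE !eqxx ?orbT.
Qed.

Section Percolation.
Variables (G0 : P -> P) (g : P -> P -> P).
Hypothesis G0P : forall v, rank v = 1%N -> (v <= G0 v)%O.
Hypothesis gP : forall v e, rank v = 1%N -> e \in edges_at v -> (e <= g v e)%O.
Hypothesis g_ind : forall v, rank v = 1%N -> forall Z : P -> Prop,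
  (forall e, e \in edges_at v -> (e <= G0 v)%O -> Z e) ->
  (forall e, e \in edges_at v -> ~~ (e <= G0 v)%O ->
     (forall e', e' \in edges_at v -> (e' <= g v e)%O -> e' != e -> Z e') -> Z e) ->
  forall e, e \in edges_at v -> Z e.
Variable k : P -> nat.
Hypothesis kI : injective k.

(** Induction on the later vertex [v] of the edge, then on the edges at [v]. An unflagged edge from
    [v] to an earlier [w] lies in a triangle with some [u] earlier than [v] in its facet: the edge
    from [w] to [u] is settled before [v], and the edge from [v] to [u] is flagged (in [G0 v]) or
    earlier in the order at [v]. *)
Lemma flags_percolate (Z : P -> Prop) :
  (forall v e, flag k G0 g v e -> Z e) ->
  (forall t e1 e2 e3, rank t = 3 -> rank e1 = 2 -> rank e2 = 2 -> rank e3 = 2 ->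
     (e1 <= t)%O -> (e2 <= t)%O -> (e3 <= t)%O -> e1 != e2 -> Z e1 -> Z e2 -> Z e3) ->
  forall e, rank e = 2 -> Z e.
Proof.
move=> Zflag Ztri.
suff ZN N : forall e, rank e = 2 -> (forall x, x \in vert e -> (k x < N)%N) -> Z e.
  move=> e e2; apply: (ZN (\max_x k x).+1) => // x _.
  by rewrite ltnS; exact: leq_bigmax.
elim: N => [|N IH] e e2 eN.
  have /card_gt0P[x xe] : (0 < #|vert e|)%N by rewrite (card_vert sP) e2.
  by have := eN x xe.
have [[v ve kv]|nv] := pselect (exists2 v, v \in vert e & k v = N); last first.
  apply: IH => // x xe; have := eN x xe; rewrite ltnS leq_eqVlt => /orP[/eqP kx|//].
  by case: nv; exists x.
have v1 := rank_vert ve.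
have ev : e \in edges_at v by rewrite inE e2 (mem_vert ve).
suff : (k (opp v e) < k v)%N -> Z e.
  apply; have := eN _ (opp_vert sP e2 ve); rewrite ltnS kv leq_eqVlt => /orP[/eqP kw|//].
  by have [/eqP] := oppP sP e2 ve; case; apply: kI; rewrite kv.
have IHe x y f : rank f = 2 -> vert f = [set x; y]%SET -> (k x < k v)%N -> (k y < k v)%N -> Z f.
  by move=> f2 vf kx ky; apply: IH => // z; rewrite vf -kv => /set2P[->|->].
move: e ev {e2 eN ve}; apply: (g_ind v1) => e ev.
  move=> eG0 wv; have [e2 ve] := edges_atP v1 ev.
  have [ov vE] := oppP sP e2 ve; set w := opp v e in wv ov vE.
  have vG : v \in vert (G0 v) by apply: vertI => //; exact: G0P.
  have wG : w \in vert (G0 v).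
    by have /fintype.subsetP := vert_mono sP eG0; apply; exact: opp_vert.
  have [u uG] := first_ex kI vG.
  have [uw|uw] := eqVneq u w.
    by apply: (Zflag v); rewrite /flag v1 eqxx ev eG0 /= -/w -uw.
  have uGv : u \in vert (G0 v) by case/andP: uG.
  have kuw : (k u < k w)%N by apply: (first_lt uG wG); rewrite eq_sym.
  have uv : u != v by apply/eqP => uv; move: kuw wv; rewrite uv; lia.
  have vw : v != w by rewrite eq_sym.
  have [t [e1 [e2' [t3 [r1 r2 e12] [l1 l2 l3 l1' l2'] ve1 ve2]]]] :=
    edge_triangle uGv vG wG uv uw vw eG0 vE.
  apply: (Ztri t e1 e2' e) => //.
    apply: (Zflag v); rewrite /flag v1 eqxx inE r1 eqxx l1' /=.
    rewrite (opp_unique sP r1 _ ve1) ?[v == u]eq_sym // uG andbT.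
    by apply: mem_vert; rewrite ve1 !inE eqxx.
  by apply: (IHe w u) => //; exact: ltn_trans wv.
move=> eG0 Zg wv; have [e2 ve] := edges_atP v1 ev.
have [ov vE] := oppP sP e2 ve; set w := opp v e in wv ov vE.
have eg := gP v1 ev.
have vG : v \in vert (g v e) by apply: vertI => //; apply: le_trans eg; exact: mem_vert.
have wG : w \in vert (g v e).
  by have /fintype.subsetP := vert_mono sP eg; apply; exact: opp_vert.
have [fl|nfl] := boolP (flag k G0 g v e); first exact: Zflag fl.
(* Since [w] precedes [v], only a third vertex of the facet preceding [v] can keep [w] and [v] from
   being its first two vertices. *)
have [u [uG uw uv kuv]] : exists u, [/\ u \in vert (g v e), u != w, u != v & (k u < k v)%N].
  apply: contrapT => nu; move/negP: nfl; apply; rewrite /flag v1 eqxx ev (negbTE eG0) /=.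
  have kvu u : u \in vert (g v e) -> u != w -> u != v -> (k v < k u)%N.
    move=> uG uw uv; rewrite ltnNge leq_eqVlt; apply/negP => /orP[/eqP/kI uvE|kuv].
      by rewrite uvE eqxx in uv.
    by apply: nu; exists u.
  apply/andP; split; apply/andP; split=> //.
  - apply/forall_inP => u uG; apply/implyP => uw.
    by have [->//|uv] := eqVneq u v; exact: ltn_trans wv (kvu u uG uw uv).
  - by rewrite in_setD1 vG eq_sym ov.
  - by apply/forall_inP => u; rewrite in_setD1 => /andP[uw uG]; apply/implyP; exact: kvu.
have vw : v != w by rewrite eq_sym.
have [t [e1 [e2' [t3 [r1 r2 e12] [l1 l2 l3 l1' l2'] ve1 ve2]]]] :=
  edge_triangle uG vG wG uv uw vw eg vE.
apply: (Ztri t e1 e2' e) => //; last by apply: (IHe w u).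
apply: Zg => //.
- by rewrite inE r1 /=; apply: mem_vert; rewrite ve1 !inE eqxx.
- apply/eqP => e1e; have : u \in vert e by rewrite -e1e ve1 !inE eqxx orbT.
  by rewrite vE !inE (negbTE uw) (negbTE uv).
- by rewrite (opp_unique sP r1 _ ve1) // eq_sym.
Qed.

Definition pick_vert F : P := odflt F [pick v in vert F].

Lemma pick_vertP F : F != \bot%O -> pick_vert F \in vert F.
Proof.
rewrite -(rank_eq0 sP) -(card_vert sP) -lt0n => /card_gt0P[v vF].
by rewrite /pick_vert; case: pickP => //= /(_ v); rewrite vF.
Qed.

Definition flagged : {set P} := [set e | [exists v, flag k G0 g v e]]%SET.

(* A vertex of each face, hence a forest, together with the second half of    *)
(* each flagged edge in the barycentric subdivision.                          *)
Definition seeds : {set P * P} :=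
  ([set (pick_vert F, F) | F in [set F | (2 <= rank F)%N]] :|:
   [set (opp (pick_vert e) e, e) | e in flagged])%SET.

Local Notation A := ([set: P] :\ (\bot)%O)%SET.

Lemma in_nonbot F : (F \in A) = (0 < rank F)%N.
Proof. by rewrite !inE andbT -(rank_eq0 sP) lt0n. Qed.

Lemma flagged_rank e : e \in flagged -> rank e = 2.
Proof.
rewrite inE => /existsP[v /and3P[/eqP v1 ev _]].
by case: (edges_atP v1 ev).
Qed.

Lemma seeds_vert F G : (F, G) \in seeds -> F \in vert G /\ (2 <= rank G)%N.
Proof.
case/setUP => /imsetP[H HP [-> ->]].
  move: HP; rewrite inE => H2; split=> //; apply: pick_vertP.
  by rewrite -(rank_eq0 sP); lia.
have H2 := flagged_rank HP; rewrite H2; split=> //.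
by apply: opp_vert => //; apply: pick_vertP; rewrite -(rank_eq0 sP) H2.
Qed.

Lemma seeds_in F G : (F, G) \in seeds -> [/\ F \in A, G \in A & (F >=< G)%O].
Proof.
move=> /seeds_vert[FG G2]; rewrite !in_nonbot (rank_vert FG); split=> //; first by lia.
by rewrite /Order.comparable (mem_vert FG).
Qed.

Lemma seeds_percolate : percolates A seeds.
Proof.
move=> K Kr Ks Kt KE.
have vA F v : v \in vert F -> v \in A by rewrite in_nonbot => /rank_vert ->.
have A2 F : rank F = 2 -> F \in A by rewrite in_nonbot => ->.
have lec F G : (F <= G)%O -> (F >=< G)%O by move=> FG; rewrite /Order.comparable FG.
have gec F G : (F <= G)%O -> (G >=< F)%O by move=> FG; rewrite /Order.comparable FG orbT.
have Kpick F : (2 <= rank F)%N -> K (pick_vert F) F.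
  by move=> F2; apply: KE; apply/setUP; left; apply/imsetP; exists F; rewrite ?inE.
pose Z e := forall v, v \in vert e -> K v e.
(* Two 2-simplices of the subdivision, on [x], [e], [t] and on [y], [e], [t], carry the relation
   from [x] to [y]. *)
have up e t x y : rank e = 2 -> (e <= t)%O -> t \in A -> Z e ->
    x \in vert e -> y \in vert e -> K x t -> K y t.
  move=> e2 et tA Ze xe ye Kxt.
  have eA := A2 _ e2; have xA := vA _ _ xe; have yA := vA _ _ ye.
  have xle := mem_vert xe; have yle := mem_vert ye.
  have Ket : K e t.
    by apply: (Kt e x t) => //; [exact: gec|exact/lec/(le_trans xle)|exact: lec|
       apply: Ks => //; [exact: lec | exact: Ze]].
  by apply: (Kt y e t) => //; [exact: lec|exact: lec|exact/lec/(le_trans yle)|exact: Ze].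
have Zall e : rank e = 2 -> Z e.
  apply: flags_percolate => [v f fl x xf|t e1 e2 e3 t3 r1 r2 r3 l1 l2 l3 e12 Z1 Z2].
    have ff : f \in flagged by rewrite inE; apply/existsP; exists v.
    have f2 := flagged_rank ff.
    have pf : pick_vert f \in vert f by apply: pick_vertP; rewrite -(rank_eq0 sP) f2.
    move: xf; rewrite (oppP sP f2 pf).2 => /set2P[->|->]; first by apply: Kpick; rewrite f2.
    by apply: KE; apply/setUP; right; apply/imsetP; exists f.
  have tA : t \in A by rewrite in_nonbot t3.
  have pt : pick_vert t \in vert t by apply: pick_vertP; rewrite -(rank_eq0 sP) t3.
  have v12 : vert e1 != vert e2.
    by apply: contra e12 => /eqP v12; apply/eqP; exact: (vert_inj sP l1 l2 v12).
  have s12 : (vert e1 :|: vert e2)%SET \subset vert t.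
    by rewrite finset.subUset !vert_mono.
  have c12 := cardsUI (vert e1) (vert e2).
  have i12 : (#|vert e1 :&: vert e2| < 2)%N.
    rewrite ltn_neqAle -{2}r1 -(card_vert sP) subset_leq_card ?finset.subsetIl // andbT.
    apply: contra v12 => /eqP c2.
    have E1 : (vert e1 :&: vert e2)%SET = vert e1.
      by apply/eqP; rewrite eqEcard finset.subsetIl (card_vert sP) r1 c2.
    by rewrite eqEcard -{1}E1 finset.subsetIr !(card_vert sP) r1 r2.
  have u12 := subset_leq_card s12.
  have r1' := card_vert sP e1; have r2' := card_vert sP e2; have t3' := card_vert sP t.
  (* Two distinct edges of a triangle cover its vertices and share one, [c]; hence the seed at [t]
     spreads along [e1] and [e2] to all vertices of [t]. *)
  have c4 : #|vert e1 :|: vert e2| + #|vert e1 :&: vert e2| = 4.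
    by rewrite c12 r1' r2' r1 r2.
  have [cU cI] : 3 <= #|vert e1 :|: vert e2| /\ 0 < #|vert e1 :&: vert e2|.
    move: i12 u12 c4; rewrite t3' t3.
    by move: #|vert e1 :|: vert e2| #|vert e1 :&: vert e2| => m n; lia.
  have U : (vert e1 :|: vert e2)%SET = vert t by apply/eqP; rewrite eqEcard s12 t3' t3.
  have /card_gt0P[c] := cI.
  rewrite inE => /andP[c1 c2].
  have Kp := Kpick t; rewrite t3 in Kp; have {}Kp := Kp erefl.
  have Kc : K c t.
    by move: pt; rewrite -U => /setUP[p1|p2]; [exact: (up e1 _ (pick_vert t)) |
      exact: (up e2 _ (pick_vert t))].
  have Ky y : y \in vert t -> K y t.
    by rewrite -U => /setUP[y1|y2]; [exact: (up e1 _ c) | exact: (up e2 _ c)].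
  have vt3 := vert_mono sP l3.
  have p3 : pick_vert e3 \in vert e3 by apply: pick_vertP; rewrite -(rank_eq0 sP) r3.
  have p3A := vA _ _ p3; have e3A := A2 _ r3; have p3l := mem_vert p3.
  (* The third edge is tied to [t] through its picked vertex, whose pair with [e3] is a seed. *)
  have Ke3 : K t e3.
    apply: (Kt t (pick_vert e3) e3) => //.
    - exact/gec/(le_trans p3l).
    - exact: lec.
    - exact: gec.
    - apply: Ks => //; first exact/lec/(le_trans p3l).
      by apply: Ky; exact: (fintype.subsetP vt3).
    - by apply: Kpick; rewrite r3.
  move=> y y3; have yA := vA _ _ y3; have yl := mem_vert y3.
  apply: (Kt y t e3) => //; [exact/lec/(le_trans yl)|exact: gec|exact: lec|].
  by apply: Ky; exact: (fintype.subsetP vt3).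
have Kv F y : y \in vert F -> K y F.
  move=> yF; have y1 := rank_vert yF; have yl := mem_vert yF.
  have [F1|F2] := leqP (rank F) 1.
    by rewrite -(rank_inj sP yl) ?y1 //; apply: Kr; rewrite in_nonbot y1.
  have F0 : F != \bot%O by rewrite -(rank_eq0 sP); lia.
  have pF := pick_vertP F0.
  have [->|py] := eqVneq y (pick_vert F); first exact: Kpick.
  have [e [eF e2 ve]] := edge_ex sP yF pF py.
  apply: (up e F (pick_vert F)) => //.
  - by rewrite in_nonbot; lia.
  - exact: Zall.
  - by rewrite ve !inE eqxx orbT.
  - by rewrite ve !inE eqxx.
  - exact: Kpick.
have Kle F G : F \in A -> G \in A -> (F <= G)%O -> K F G.
  move=> FA GA FG.
  have F0 : F != \bot%O by rewrite -(rank_eq0 sP) -lt0n -in_nonbot.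
  have pF := pick_vertP F0; have pl := mem_vert pF.
  apply: (Kt F (pick_vert F) G) => //.
  - exact: vA pF.
  - exact: gec.
  - exact/lec/(le_trans pl).
  - exact: lec.
  - by apply: Ks => //; [exact: vA pF | exact: lec | exact: Kv].
  - by apply: Kv; exact: (fintype.subsetP (vert_mono sP FG)).
move=> F G FA GA /orP[FG|GF]; first exact: Kle.
by apply: Ks => //; [exact: lec | exact: Kle].
Qed.

Lemma card_seeds :
  (#|seeds| <= #|[set F : P | (2 <= rank F)%N]%SET| + #|flagged|)%N.
Proof.
apply: leq_trans (leq_card_setU _ _) _.
by apply: leq_add; exact: leq_imset_card.
Qed.

End Percolation.
End Flags.

(** * Averaging over all orderings *)

Section DoubleCounting.
Local Open Scope nat_scope.

Lemma disjoint_bound (I T : finType) (J : {set I}) (S : I -> {set T}) (U : {set T}) c :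
  (forall i, i \in J -> c <= #|S i|) -> (forall i, i \in J -> S i \subset U) ->
  (forall i j x, i \in J -> j \in J -> x \in S i -> x \in S j -> i = j) ->
  #|J| * c <= #|U|.
Proof.
move=> cS SU dS; apply: (@leq_trans (\sum_(i in J) #|S i|)).
  by rewrite -sum_nat_const; apply: leq_sum.
have -> : \sum_(i in J) #|S i| = \sum_(i in J) \sum_(x in U) (x \in S i).
  apply: eq_bigr => i iJ; rewrite -big_mkcondr /= sum1dep_card.
  apply: eq_card => x; rewrite !inE; apply/idP/andP => [xS|[]//].
  by split=> //; exact: (fintype.subsetP (SU i iJ)).
rewrite exchange_big /= -sum1_card; apply: leq_sum => x _.
rewrite -big_mkcondr /= sum1dep_card.
apply/card_le1P => i; rewrite inE => /andP[iJ xi] j.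
rewrite inE; apply/andP/idP => [[jJ xj]|]; first by rewrite inE; apply/eqP; exact: (dS _ _ x).
by rewrite inE => /eqP ->.
Qed.

Context {disp : Order.disp_t} {P : finBPOrderType disp}.
Implicit Types (F G H e u v w x y : P) (D : {set P}).

Definition perm_key (s : {perm P}) (x : P) : nat := enum_rank (s x).

Lemma perm_key_inj s : injective (perm_key s).
Proof. by move=> x y /val_inj /enum_rank_inj /perm_inj. Qed.

Lemma first_unique (k : P -> nat) D w w' : first k D w -> first k D w' -> w = w'.
Proof.
move=> fw fw'; apply/eqP; apply: contrapT => /negP ww'.
have w'w : w' != w by rewrite eq_sym.
have := first_lt fw (proj1 (andP fw')) w'w; have := first_lt fw' (proj1 (andP fw)) ww'.
by move=> /ltnW; rewrite leqNgt => /negP.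
Qed.

Lemma first_tperm s D x y w : x \in D -> y \in D ->
  first (perm_key s) D (tperm x y w) -> first (perm_key (tperm x y * s)%g) D w.
Proof.
move=> xD yD.
have st z : (tperm x y z \in D) = (z \in D).
  by case: tpermP => [->|->|]; rewrite ?xD ?yD.
case/andP => wD /forall_inP fw; apply/andP; split; first by rewrite -st.
apply/forall_inP => u uD; apply/implyP => uw; rewrite /perm_key !permM.
apply: (implyP (fw (tperm x y u) _)); first by rewrite st.
by apply: contra uw => /eqP/perm_inj ->.
Qed.

(** All members of [D] are equally likely to come first: multiplying by a transposition carries the
    event for [w] into the event for any other member, and these events are disjoint. *)
Lemma card_first D w : w \in D ->
  #|D| * #|[set s | first (perm_key s) D w]%SET| <= #|{perm P}|.
Proof.
move=> wD; rewrite -cardsT.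
apply: (@disjoint_bound _ _ D (fun w' => [set s | first (perm_key s) D w']%SET)) => [x xD|x _|x y s _ _].
- have <- := card_imset [set s | first (perm_key s) D w]%SET (@mulgI _ (tperm w x)).
  apply/subset_leq_card/fintype.subsetP => _ /imsetP[s + ->]; rewrite !inE => fs.
  by apply: first_tperm => //; rewrite tpermR.
- exact: finset.subsetT.
- by rewrite !inE; exact: first_unique.
Qed.

Lemma card_first2 D w v : w \in D -> v \in D -> v != w ->
  #|D| * (#|D|.-1 * #|[set s | first (perm_key s) D w &&
                                first (perm_key s) (D :\ w)%SET v]%SET|) <= #|{perm P}|.
Proof.
move=> wD vD vw; apply: leq_trans (card_first wD); rewrite leq_mul2l; apply/orP; right.
have -> : #|D|.-1 = #|(D :\ w)%SET| by rewrite (cardsD1 w) wD.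
apply: (@disjoint_bound _ _ (D :\ w)%SET (fun v' => [set s | first (perm_key s) D w &&
      first (perm_key s) (D :\ w)%SET v']%SET)) => [x xD|x _|x y s _ _].
- have <- := card_imset [set s | first (perm_key s) D w &&
      first (perm_key s) (D :\ w)%SET v]%SET (@mulgI _ (tperm v x)).
  apply/subset_leq_card/fintype.subsetP => _ /imsetP[s + ->]; rewrite !inE => /andP[fw fv].
  move: (xD); rewrite in_setD1 => /andP[xw xD'].
  rewrite !first_tperm ?tpermR ?tpermD // !inE ?vw //.
- by apply/fintype.subsetP => s; rewrite !inE => /andP[].
- by rewrite !inE => /andP[_ fx] /andP[_ fy]; exact: first_unique fx fy.
Qed.

Hypothesis sP : simplicial_poset P.
Variables (d : nat) (G0 : P -> P) (g : P -> P -> P).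
Hypothesis G0P : forall v, rank v = 1 -> rank (G0 v) = d.+1 /\ (v <= G0 v)%O.
Hypothesis gP : forall v e, rank v = 1 -> e \in edges_at v ->
  rank (g v e) = d.+1 /\ (e <= g v e)%O.

(** The two flag probabilities with denominators cleared; the facets involved have [d.+1]
    vertices. *)
Lemma card_flag v e : rank v = 1 -> e \in edges_at v ->
  d * d.+1 * #|[set s | flag (perm_key s) G0 g v e]%SET| <=
    #|{perm P}| * (if (e <= G0 v)%O then d else 1).
Proof.
move=> v1 ev; have [e2 ve] := edges_atP v1 ev; have [ov vE] := oppP sP e2 ve.
have [G0d vG0] := G0P v1; have [gd eg] := gP v1 ev.
case: ifP => eG.
  rewrite -mulnA mulnC leq_mul2r; apply/orP; right.
  have oG : opp v e \in vert (G0 v).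
    by apply: (fintype.subsetP (vert_mono sP eG)); exact: opp_vert.
  have := card_first oG; rewrite (card_vert sP) G0d; congr (_ * _ <= _).
  by apply: eq_card => s; rewrite !inE /flag v1 eG ev.
rewrite muln1.
have og : opp v e \in vert (g v e).
  by apply: (fintype.subsetP (vert_mono sP eg)); exact: opp_vert.
have vg : v \in vert (g v e).
  by apply: (fintype.subsetP (vert_mono sP eg)).
have := @card_first2 _ _ v og vg; rewrite eq_sym ov (card_vert sP) gd => /(_ erefl).
rewrite mulnA [d.+1 * _]mulnC; congr (_ * _ <= _).
by apply: eq_card => s; rewrite !inE /flag v1 eG ev.
Qed.

Local Notation V := [set v : P | rank v == 1]%SET.

Lemma sum_edges_at : \sum_(v in V) #|edges_at v| = 2 * #|[set e : P | rank e == 2]%SET|.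
Proof.
have -> : \sum_(v in V) #|edges_at v| =
    \sum_(v in V) \sum_(e in [set e : P | rank e == 2]%SET) (v <= e)%O.
  apply: eq_bigr => v _; rewrite -big_mkcondr /= sum1dep_card.
  by apply: eq_card => e; rewrite !inE.
rewrite exchange_big /= mulnC -sum_nat_const; apply: eq_bigr => e; rewrite inE => /eqP <-.
rewrite -big_mkcondr /= sum1dep_card -(card_vert sP).
by apply: eq_card => v; rewrite !inE.
Qed.

(** Some permutation does at least as well as the average. The term [d * #|V|] stands on the left to
    avoid truncated subtraction. *)
Lemma few_flagged : exists s : {perm P},
  d * d.+1 * #|flagged G0 g (perm_key s)| + d * #|V| <=
    d * d * #|V| + 2 * #|[set e : P | rank e == 2]%SET|.
Proof.
pose c v e := if (e <= G0 v)%O then d else 1.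
pose B := \sum_(v in V) \sum_(e in edges_at v) c v e.
(* A vertex has [d] edges in [G0 v], each of weight [d], and its remaining edges have weight 1. *)
have BE : B + d * #|V| = d * d * #|V| + 2 * #|[set e : P | rank e == 2]%SET|.
  rewrite -sum_edges_at ![_ * #|V|]mulnC -!sum_nat_const -!big_split /=.
  apply: eq_bigr => v; rewrite inE => /eqP v1; have [G0d vG0] := G0P v1.
  rewrite (bigID (fun e => (e <= G0 v)%O)) /=.
  have dE : #|[set e in edges_at v | (e <= G0 v)%O]%SET| = d.
    by rewrite (card_edges_at sP v1 vG0) G0d.
  rewrite (eq_bigr (fun=> d)); last by move=> e /andP[_ eG]; rewrite /c eG.
  rewrite [X in _ + X + _](eq_bigr (fun=> 1)); last first.
    by move=> e /andP[_ eG]; rewrite /c (negbTE eG).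
  have cst_sum n : \sum_(e in edges_at v | (e <= G0 v)%O) n = d * n.
    rewrite -dE -sum_nat_const; apply: eq_bigl => e; by rewrite inE.
  rewrite cst_sum -[#|edges_at v|]sum1_card.
  rewrite [in RHS](bigID (fun e => (e <= G0 v)%O)) /= cst_sum muln1.
  by rewrite addnCA addnA [d + _]addnC addnAC.
rewrite -BE.
apply: contrapT => nex.
have lt s : B.+1 <= d * d.+1 * #|flagged G0 g (perm_key s)|.
  by rewrite ltnNge; apply/negP => le; apply: nex; exists s; rewrite leq_add2r.
have N0 : 0 < #|{perm P}| by apply/card_gt0P; exists 1%g.
suff : #|{perm P}| * B.+1 <= #|{perm P}| * B by rewrite leq_pmul2l // ltnn.
rewrite -sum_nat_const; apply: (leq_trans (leq_sum _ (fun s _ => lt s))).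
rewrite -big_distrr /=.
apply: (@leq_trans (d * d.+1 * \sum_(v in V) \sum_(e in edges_at v)
    #|[set s | flag (perm_key s) G0 g v e]%SET|)).
  rewrite leq_mul2l; apply/orP; right.
  have -> : \sum_(v in V) \sum_(e in edges_at v) #|[set s | flag (perm_key s) G0 g v e]%SET| =
      \sum_(s : {perm P}) \sum_(v in V) \sum_(e in edges_at v) flag (perm_key s) G0 g v e.
    rewrite [RHS]exchange_big /=; apply: eq_bigr => v _.
    rewrite [RHS]exchange_big /=; apply: eq_bigr => e _.
    by rewrite -big_mkcondr /= sum1dep_card.
  apply: leq_sum => s _.
  rewrite -sum1_card.
  have Vsum : \sum_(v in V) \sum_(e in edges_at v) flag (perm_key s) G0 g v e =
      \sum_e \sum_v flag (perm_key s) G0 g v e.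
    rewrite [RHS]exchange_big /= [LHS]big_mkcond; apply: eq_bigr => v _.
    case: ifPn => vV; last first.
      by rewrite big1 // => e _; rewrite /flag; move: vV; rewrite inE => /negbTE ->.
    rewrite big_mkcond; apply: eq_bigr => e _; case: ifPn => // ev.
    by rewrite /flag (negbTE ev) andbF.
  rewrite Vsum big_mkcond; apply: leq_sum => e _; case: ifP => //.
  rewrite inE => /existsP[v fv]; rewrite (bigD1 v) //= fv; exact: leq_addr.
rewrite big_distrr big_distrr /=; apply: leq_sum => v; rewrite inE => /eqP v1.
by rewrite !big_distrr /=; apply: leq_sum => e ev; exact: card_flag.
Qed.
End DoubleCounting.

(** * Face numbers *)

Section Numbers.
Context {disp : Order.disp_t} (P : finBPOrderType disp).
Hypothesis sP : simplicial_poset P.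

Lemma f_number_rank (j : nat) :
  f_number P (j%:Z - 1) = #|[set F : P | rank F == j]%SET|.
Proof.
rewrite /f_number; apply: eq_card => F; rewrite !inE /face_dim.
by apply/eqP/eqP; lia.
Qed.

Lemma h_number2 d : (1 <= d)%N -> h_number P d 2 =
  'C(d.+1, 2)%:Z - d%:Z * #|[set F : P | rank F == 1%N]%SET|%:Z +
    #|[set F : P | rank F == 2%N]%SET|%:Z.
Proof.
move=> d1; rewrite /h_number !big_ord_recl big_ord0 /= !f_number_rank /=.
have -> : #|[set F : P | rank F == 0%N]%SET| = 1%N.
  rewrite -(cards1 (\bot%O : P)); apply: eq_card => F.
  by rewrite !inE (rank_eq0 sP).
rewrite /bump /= !addn0 !addn1 !subSS !subn0 bin0 bin1.
by rewrite expr0 expr1 expr2; ring.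
Qed.

Lemma facet_exists d : poset_dim P = d%:Z -> pure P ->
  forall F : P, exists2 G, (F <= G)%O & rank G = d.+1.
Proof.
move=> dimP pP F.
have maxP : \max_(F : P) rank F = d.+1 by move: dimP; rewrite /poset_dim; lia.
have rle (G : P) : (rank G <= d.+1)%N by rewrite -maxP; exact: leq_bigmax.
have [|F1 F1E] := @bigop.eq_bigmax P (@rank disp P); first by apply/card_gt0P; exists F.
have F1max : maximal_face F1.
  by move=> G FG; apply/esym/(rank_inj sP FG); rewrite -F1E maxP.
case: (@arg_maxnP _ F (fun G => (F <= G)%O) (@rank disp P)) => [|G FG Gmax]; first exact: lexx.
have GM : maximal_face G.
  move=> H GH; apply/esym/(rank_inj sP GH); apply: Gmax; exact: le_trans GH.
exists G => //; have := pP _ _ GM F1max; rewrite /face_dim -F1E maxP; lia.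
Qed.

End Numbers.

(** * The inequality for h_2 *)

Unset Implicit Arguments.
Set Strict Implicit.
Set Printing Implicit Defensive.

Theorem theorem1p3 (R : realType) (d : nat) (disp : Order.disp_t)
    (Delta : finBPOrderType disp) :
  (2 <= d)%N ->
  simplicial_poset Delta ->
  poset_dim Delta = d%:Z ->
  pure Delta ->
  connected (realization Delta R) ->
  (forall F : Delta, face_dim F <= d%:Z - 2 ->
     connected (link_realization R F)) ->
  forall b : {ptws Delta -> R}, realization Delta R b ->
  exists2 m : nat, pi1_min_generators (R := R) (realization Delta R) b m &
    ('C(d.+1, 2) * m)%:Z <= h_number Delta d 2.
Proof.
move=> d2 sP dimP pP conX conL b Xb.
have facets := facet_exists sP dimP pP.
have linkC (F : Delta) : (rank F < d)%N -> forall B : Delta -> Prop,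
    (forall G H, (F < G)%O -> (F < H)%O -> (G >=< H)%O -> B G -> B H) ->
    forall G H, (F < G)%O -> (F < H)%O -> B G -> B H.
  move=> Fd B BC G H FG FH.
  have inL K : (K \in (link F :\ F)%SET) = (F < K)%O.
    by rewrite !inE lt_neqAle eq_sym andbC.
  have Fd' : face_dim F <= d%:Z - 2 by rewrite /face_dim; lia.
  apply: (connected_order_complex (conL F Fd')); rewrite ?inL //.
  by move=> K L; rewrite !inL; exact: BC.
have /choice[s sE] : forall v : Delta, exists s : Delta * (Delta -> Delta), rank v = 1%N ->
  [/\ rank s.1 = d.+1, (v <= s.1)%O,
      forall e, e \in edges_at v -> rank (s.2 e) = d.+1 /\ (e <= s.2 e)%O &
      forall Z : Delta -> Prop,
        (forall e, e \in edges_at v -> (e <= s.1)%O -> Z e) ->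
        (forall e, e \in edges_at v -> ~~ (e <= s.1)%O ->
           (forall e', e' \in edges_at v -> (e' <= s.2 e)%O -> e' != e -> Z e') -> Z e) ->
        forall e, e \in edges_at v -> Z e].
  (* Faces that are not vertices receive an arbitrary value. *)
  move=> v; have [v1|v1] := eqVneq (rank v) 1%N; last first.
    by exists (v, id) => v1'; move: v1; rewrite v1'.
  by have [G0 [g G0P]] := link_induction sP facets linkC v1 d2; exists (G0, g).
pose G0 v := (s v).1; pose g v := (s v).2.
have [|v e v1|sigma few] := @few_flagged _ _ sP d G0 g.
- by move=> v v1; have [] := sE v v1.
- by have [_ _ + _] := sE v v1; apply.
have kI := @perm_key_inj _ _ sigma.
have perc : percolates ([set: Delta] :\ \bot%O)%SET (seeds G0 g (perm_key sigma)).
  apply: seeds_percolate => //.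
  - by move=> v v1; have [] := sE v v1.
  - by move=> v e v1 ev; have [_ _ /(_ e ev)[]] := sE v v1.
  - by move=> v v1; have [] := sE v v1.
have [n gen_n nE] := pi1_percolates (@seeds_in _ _ sP G0 g _) perc conX Xb.
have exg : exists m, `[< pi1_generated (R := R) (realization Delta R) b m >].
  by exists n; apply/asboolP.
have [m /asboolP gen_m m_min] := ex_minnP exg.
have mn : (m <= n)%N by apply: m_min; apply/asboolP.
exists m; first by split=> // k gk; apply: m_min; apply/asboolP.
rewrite h_number2 //; last exact: ltnW.
have cA : #|([set: Delta] :\ \bot%O)%SET| =
    (#|[set F : Delta | rank F == 1%N]%SET| + #|[set F : Delta | (2 <= rank F)%N]%SET|)%N.
  rewrite -cardsUI [X in (_ + X)%N]eq_card0 ?addn0; last first.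
    by move=> F; rewrite !inE; case: (rank F) => [|[|]].
  apply: eq_card => F; rewrite (in_nonbot sP) !inE.
  by case: (rank F) => [|[|]].
have cS := card_seeds G0 g (perm_key sigma).
rewrite cA in nE; move: few cS nE.
set f0 := #|[set F : Delta | rank F == 1%N]%SET|.
set f1 := #|[set F : Delta | rank F == 2%N]%SET|.
move: #|flagged _ _ _| #|seeds _ _ _| #|[set F : Delta | (2 <= rank F)%N]%SET| => S E f2.
move=> few cS nE.
(* The number [f2] of faces of rank at least 2 occurs both in [#|A|] and in the bound on the seeds,
   and cancels. *)
have nS : (n + f0 <= S.+1)%N by lia.
have C2 : ('C(d.+1, 2) * 2 = d * d.+1)%N.
  by rewrite bin2 muln2 halfK oddM /= andNb subn0 mulnC.
(* Twice h_2 is d(d+1) - 2 d f_0 + 2 f_1, which is what [few] leaves as a bound for d(d+1) n. *)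
move: nS few mn C2; clear; move: 'C(d.+1, 2) => C nS few mn C2.
nia.
Qed.
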